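(* Let $F|K$ be an algebraic function field such that $K$ is existentially closed in $F$. Take any elements $z_1,\ldots,z_n\in F$. Then there are infinitely many rational places of $F|K$ of maximal rank which are finite on $z_1,\ldots,z_n$.
   Context: An algebraic function field $F|K$ is a finitely generated field extension of transcendence degree at least $1$; the characteristic is arbitrary. A place of $F|K$ is a place $P$ of $F$ whose restriction to $K$ is the identity; places are considered up to equivalence. $FP$ is the residue field, $v_PF$ the value group. $P$ is rational if $FP=K$; it is of maximal rank if the rank of $v_PF$ (the number of its proper convex subgroups) equals $\operatorname{trdeg}F|K$; it is finite on $z$ if $zP\ne\infty$, i.e. $z$ lies in the valuation ring of $P$. $K$ is existentially closed in an extension field $L$ if for all $m,n\in\mathbb N$ and all polynomials $f_1,\ldots,f_n,g\in K[X_1,\ldots,X_m]$, whenever $f_1,\ldots,f_n$ have a common zero in $L^m$ which is not a zero of $g$, they also have a common zero in $K^m$ which is not a zero of $g$. *)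

(* Defs.v *)
From HB Require Import structures.
From mathcomp Require Import all_boot all_order all_algebra.
From mathcomp Require Import boolp classical_sets functions cardinality.
From mathcomp Require Import mpoly.

Set Implicit Arguments.
Unset Strict Implicit.
Unset Printing Implicit Defensive.

Import Order.TTheory GRing.Theory.

Local Open Scope quotient_scope.
Local Open Scope classical_set_scope.
Local Open Scope card_scope.
Local Open Scope ring_scope.

(* A place of F with values in L together with oo; [None] stands for oo. *)
Record place (F L : fieldType) := Place {
  place_fun :> F -> option L;
  place1 : place_fun 1 = Some 1;
  placeD : forall x y a b, place_fun x = Some a -> place_fun y = Some b ->
    place_fun (x + y) = Some (a + b);
  placeM : forall x y a b, place_fun x = Some a -> place_fun y = Some b ->
    place_fun (x * y) = Some (a * b);
  placeV : forall x, place_fun x = None -> place_fun x^-1 = Some 0 }.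

Definition finite_on (F L : fieldType) (P : place F L) (x : F) : bool :=
  isSome (P x).

Section FiniteOn.
Variables (F L : fieldType) (P : place F L).

Lemma finite_on1 : finite_on P 1.
Proof. by rewrite /finite_on place1. Qed.

Lemma finite_onM x y : finite_on P x -> finite_on P y -> finite_on P (x * y).
Proof.
rewrite /finite_on; case Ex: (P x) => [a|//]; case Ey: (P y) => [b|//] _ _.
by rewrite (placeM Ex Ey).
Qed.

Lemma finite_onV x : finite_on P x || finite_on P x^-1.
Proof. by rewrite /finite_on; case Ex: (P x) => //=; rewrite (placeV Ex). Qed.

End FiniteOn.

(* The value group is the quotient of the multiplicative group of F by the
   units of the valuation ring of P, written additively, and ordered by
   v x <= v y iff y / x lies in the valuation ring. *)
Section ValueGroup.
Variables (F L : fieldType) (P : place F L).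

Definition nzelt := {x : F | x != 0}.

Definition val_le (x y : nzelt) : bool := finite_on P (val y / val x).

Lemma val_le_refl : reflexive val_le.
Proof. by move=> x; rewrite /val_le divff ?(valP x) // finite_on1. Qed.

Lemma val_le_trans : transitive val_le.
Proof.
move=> y x z; rewrite /val_le => xy yz.
by have := finite_onM yz xy; rewrite mulrA divfK ?(valP y).
Qed.

Definition val_eq : rel nzelt := fun x y => val_le x y && val_le y x.

Lemma val_eq_refl : reflexive val_eq.
Proof. by move=> x; rewrite /val_eq val_le_refl. Qed.

Lemma val_eq_sym : ssrbool.symmetric val_eq.
Proof. by move=> x y; rewrite /val_eq andbC. Qed.

Lemma val_eq_trans : transitive val_eq.
Proof.
move=> y x z /andP[xy yx] /andP[yz zy].
by rewrite /val_eq (val_le_trans xy yz) (val_le_trans zy yx).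
Qed.

Canonical val_eq_equiv := EquivRel val_eq val_eq_refl val_eq_sym val_eq_trans.

Definition value_group := {eq_quot val_eq}.

HB.instance Definition _ := Choice.on value_group.
HB.instance Definition _ : EqQuotient nzelt val_eq_equiv value_group :=
  EqQuotient.on value_group.

Definition nz_one : nzelt := exist (fun u : F => u != 0) 1 (oner_neq0 F).

Lemma nz_mul_subproof (x y : nzelt) : val x * val y != 0.
Proof. by rewrite mulf_neq0 ?(valP x) ?(valP y). Qed.
Definition nz_mul (x y : nzelt) : nzelt := exist (fun u : F => u != 0) _ (nz_mul_subproof x y).

Lemma nz_inv_subproof (x : nzelt) : (val x)^-1 != 0.
Proof. by rewrite invr_neq0 ?(valP x). Qed.
Definition nz_inv (x : nzelt) : nzelt := exist (fun u : F => u != 0) _ (nz_inv_subproof x).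

Definition vadd (g h : value_group) : value_group :=
  \pi_value_group (nz_mul (repr g) (repr h)).
Definition vopp (g : value_group) : value_group :=
  \pi_value_group (nz_inv (repr g)).
Definition vzero : value_group := \pi_value_group nz_one.
Definition vle (g h : value_group) : bool := val_le (repr g) (repr h).

Definition val_of (x : nzelt) : value_group := \pi_value_group x.

Lemma val_ofK g : val_of (repr g) = g.
Proof. exact: reprK. Qed.

Lemma val_ofP x y : reflect (val_of x = val_of y) (val_eq x y).
Proof. exact: eqmodP. Qed.

Lemma repr_val_of x : val_eq (repr (val_of x)) x.
Proof. by apply/val_ofP; rewrite val_ofK. Qed.

Lemma val_le_mul x x' y y' :
  val_le x x' -> val_le y y' -> val_le (nz_mul x y) (nz_mul x' y').
Proof. by move=> hx /(finite_onM hx); rewrite /val_le /= mulf_div. Qed.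

Lemma val_le_inv x y : val_le x y -> val_le (nz_inv y) (nz_inv x).
Proof. by rewrite /val_le /= invrK mulrC. Qed.

Lemma vaddE x y : vadd (val_of x) (val_of y) = val_of (nz_mul x y).
Proof.
apply/val_ofP.
have /andP[x1 x2] := repr_val_of x; have /andP[y1 y2] := repr_val_of y.
by rewrite /val_eq !val_le_mul.
Qed.

Lemma voppE x : vopp (val_of x) = val_of (nz_inv x).
Proof.
apply/val_ofP; have /andP[x1 x2] := repr_val_of x.
by rewrite /val_eq !val_le_inv.
Qed.

Lemma vleE x y : vle (val_of x) (val_of y) = val_le x y.
Proof.
have /andP[x1 x2] := repr_val_of x; have /andP[y1 y2] := repr_val_of y.
rewrite /vle; apply/idP/idP => h.
  exact: val_le_trans x2 (val_le_trans h y1).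
exact: val_le_trans x1 (val_le_trans h y2).
Qed.

Lemma vaddA : associative vadd.
Proof.
move=> g h k; rewrite -(val_ofK g) -(val_ofK h) -(val_ofK k) !vaddE.
by congr val_of; apply: val_inj; rewrite /= mulrA.
Qed.

Lemma vaddC : commutative vadd.
Proof.
move=> g h; rewrite -(val_ofK g) -(val_ofK h) !vaddE.
by congr val_of; apply: val_inj; rewrite /= mulrC.
Qed.

Lemma vadd0 : left_id vzero vadd.
Proof.
move=> g; rewrite -(val_ofK g) vaddE.
by congr val_of; apply: val_inj; rewrite /= mul1r.
Qed.

Lemma vaddN : left_inverse vzero vopp vadd.
Proof.
move=> g; rewrite -(val_ofK g) voppE vaddE.
by congr val_of; apply: val_inj; rewrite /= mulVf ?(valP (repr g)).
Qed.

HB.instance Definition _ :=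
  GRing.isZmodule.Build value_group vaddA vaddC vadd0 vaddN.

Lemma vle_refl : reflexive vle.
Proof. by move=> g; rewrite /vle val_le_refl. Qed.

Lemma vle_anti : antisymmetric vle.
Proof. by move=> g h gh; rewrite -(val_ofK g) -(val_ofK h); apply/val_ofP. Qed.

Lemma vle_trans : transitive vle.
Proof. by move=> h g k; apply: val_le_trans. Qed.

Lemma vle_total : total vle.
Proof.
by move=> g h; rewrite /vle /val_le -[X in _ || finite_on _ X]invf_div finite_onV.
Qed.

HB.instance Definition _ :=
  Order.Le_isPOrder.Build ring_display value_group vle_refl vle_anti vle_trans.
HB.instance Definition _ :=
  Order.POrder_isTotal.Build ring_display value_group vle_total.

Lemma value_group_leD (g h k : value_group) : g <= h -> g + k <= h + k.
Proof.
rewrite -(val_ofK g) -(val_ofK h) -(val_ofK k) => gh.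
have -> : val_of (repr g) + val_of (repr k) = val_of (nz_mul (repr g) (repr k)).
  exact: vaddE.
have -> : val_of (repr h) + val_of (repr k) = val_of (nz_mul (repr h) (repr k)).
  exact: vaddE.
have {}gh : val_le (repr g) (repr h) by rewrite -vleE.
by rewrite [_ <= _]vleE val_le_mul ?val_le_refl.
Qed.

End ValueGroup.

Definition convex_subgroup (G : porderZmodType) (H : set G) : Prop :=
  [/\ H 0, forall x y, H x -> H y -> H (x - y)
    & forall x y z, H x -> H z -> x <= y -> y <= z -> H y].

Definition has_rank (G : porderZmodType) (d : nat) : Prop :=
  [set H : set G | convex_subgroup H /\ H <> setT] #= `I_d.

Section FunctionField.
Variables (K F : fieldType) (iota : {rmorphism K -> F}).

Definition existentially_closed : Prop :=
  forall (m n : nat) (f : 'I_n -> {mpoly K[m]}) (g : {mpoly K[m]}),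
    (exists x : 'I_m -> F,
       (forall i, (map_mpoly iota (f i)).@[x] = 0) /\
       (map_mpoly iota g).@[x] <> 0) ->
    exists y : 'I_m -> K, (forall i, (f i).@[y] = 0) /\ g.@[y] <> 0.

Definition finitely_generated : Prop :=
  exists s : seq F, forall E : {pred F}, GRing.divring_closed E ->
    (forall a, iota a \in E) -> {subset s <= E} -> forall x, x \in E.

Definition algebraically_independent (n : nat) (t : n.-tuple F) : Prop :=
  forall p : {mpoly K[n]}, (map_mpoly iota p).@[tnth t] = 0 -> p = 0.

Definition transcendence_basis (n : nat) (t : n.-tuple F) : Prop :=
  algebraically_independent t /\
  forall x, ~ algebraically_independent (cons_tuple x t).

Definition has_trdeg (d : nat) : Prop :=
  exists t : d.-tuple F, transcendence_basis t.

Definition function_field : Prop :=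
  finitely_generated /\ exists d, (0 < d)%N /\ has_trdeg d.

(* The target field is any extension of K; the residue field FP is the set of
   finite values, a subfield of it containing K. *)
Record fplace := FPlace {
  fplace_target : fieldType;
  fplace_emb : {rmorphism K -> fplace_target};
  fplace_place :> place F fplace_target;
  fplace_id : forall a, fplace_place (iota a) = Some (fplace_emb a) }.

Arguments fplace_emb : clear implicits.

Definition residue_field (P : fplace) : set (fplace_target P) :=
  [set a | exists x, P x = Some a].

Arguments residue_field : clear implicits.

Definition rational_place (P : fplace) : Prop :=
  residue_field P = range (fplace_emb P).

Definition maximal_rank (P : fplace) : Prop :=
  exists d, has_trdeg d /\ has_rank (value_group P) d.

(* Equivalent places are those with the same valuation ring. *)
Definition place_equiv (P Q : fplace) : Prop := finite_on P =1 finite_on Q.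

Definition infinitely_many_places (A : fplace -> Prop) : Prop :=
  exists P : nat -> fplace,
    (forall i, A (P i)) /\ (forall i j, place_equiv (P i) (P j) -> i = j).

End FunctionField.

(* Main.v *)
Require Import Defs.
From HB Require Import structures.
From mathcomp Require Import all_boot all_order all_algebra.
From mathcomp Require Import boolp classical_sets functions cardinality.
From mathcomp Require Import mpoly.
From mathcomp Require Import ring zify.

(** Let [s] be a list of elements that contains generators of [F] over [K] and
    the elements [z i]. The idea is to embed the algebra [K[s]] into the ring of
    power series over [K] in [d] variables, where [d] is the transcendence degree.
    The leading monomials of power series for the lexicographic order define a
    valuation with value group the lexicographic power of the integers, of rank
    [d], and with residue field [K]. It is trivial on [K] and nonnegative on power
    series, in particular on the [z i]. Its restriction to [F] keeps the rank,
    because the variables of the power series ring lie in the image of [K[s]].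

    Geometrically the embedding is the completion at a smooth rational point of the
    variety with coordinate ring [K[s]]. That the generic point is smooth, that is,
    that [F] is separably generated, is MacLane's criterion
    [relation_simple_root]: it rests on the linear disjointness of [F] from the
    [p]-th roots of [K] ([frobenius_dependence]), a consequence of existential
    closedness. Consequently [s] can be ordered such that [F] is built from [K] by
    a transcendence basis [t], followed by simple roots of polynomials over what
    precedes ([exists_separable_tower]).

    Along this tower the embedding is constructed one element at a time, for all
    points that satisfy finitely many polynomial conditions valid at the generic
    point. A member of [t] is sent to its residue plus a new variable
    ([smooth_transcendental]). A simple root is sent to the root of its minimal
    equation that Hensel's lemma produces ([smooth_separable], [hensel_pser]);
    injectivity is preserved because the equation stays minimal over the power
    series ([minimal_vanishing_transfer]). Existential closedness provides a
    rational point that satisfies the conditions ([exists_rational_point]).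

    The rank is computed from the values of the variables, each of which is
    infinitely larger than the preceding one ([rank_of_generators]). Finally, the
    value at the point of the first transcendental element can be required to avoid
    any finite subset of [K]. This yields infinitely many places, which are
    inequivalent since they take different values at that element
    ([infinitely_many_places_of_values]). *)

Set Implicit Arguments.
Unset Strict Implicit.
Unset Printing Implicit Defensive.

Import Order.TTheory GRing.Theory.

Local Open Scope ring_scope.

(** * Power series and Hensel's lemma *)

(** An alias of [nat -> R], so that the ring structure is the one given by the
    Cauchy product and not the pointwise one. *)
Definition pser (R : nzRingType) : Type := nat -> R.

Section PowerSeries.
Variable R : comNzRingType.

HB.instance Definition _ := Choice.copy (pser R) (nat -> R).

Implicit Types f g h : pser R.

Definition ps_zero : pser R := fun=> 0.
Definition ps_one : pser R := fun n => (n == 0)%:R.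
Definition ps_opp f : pser R := fun n => - f n.
Definition ps_add f g : pser R := fun n => f n + g n.
Definition ps_mul f g : pser R := fun n => \sum_(i < n.+1) f i * g (n - i)%N.

Fact ps_addA : associative ps_add.
Proof. by move=> f g h; apply/funext => n; apply: addrA. Qed.
Fact ps_addC : commutative ps_add.
Proof. by move=> f g; apply/funext => n; apply: addrC. Qed.
Fact ps_add0 : left_id ps_zero ps_add.
Proof. by move=> f; apply/funext => n; apply: add0r. Qed.
Fact ps_addN : left_inverse ps_zero ps_opp ps_add.
Proof. by move=> f; apply/funext => n; apply: addNr. Qed.

HB.instance Definition _ :=
  GRing.isZmodule.Build (pser R) ps_addA ps_addC ps_add0 ps_addN.

Definition ps_trunc N f : {poly R} := \poly_(i < N) f i.

(** A coefficient of a product only involves finitely many coefficients of the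
    factors, so the ring laws are inherited from polynomials. *)
Lemma ps_mul_trunc N f g n : (n < N)%N ->
  ps_mul f g n = (ps_trunc N f * ps_trunc N g)`_n.
Proof.
move=> nN; rewrite coefM; apply: eq_bigr => i _; rewrite !coef_poly.
by rewrite (leq_ltn_trans _ nN) ?leq_ord // (leq_ltn_trans (leq_subr _ _) nN).
Qed.

Fact ps_mulA : associative ps_mul.
Proof.
move=> f g h; apply/funext => n.
transitivity ((ps_trunc n.+1 f * (ps_trunc n.+1 g * ps_trunc n.+1 h))`_n).
  rewrite coefM; apply: eq_bigr => i _.
  by rewrite coef_poly ltn_ord (@ps_mul_trunc n.+1) // ltnS leq_subr.
rewrite mulrA coefM; apply: eq_bigr => i _.
by rewrite coef_poly ltnS leq_subr (@ps_mul_trunc n.+1).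
Qed.

Fact ps_mulC : commutative ps_mul.
Proof.
by move=> f g; apply/funext => n; rewrite !(@ps_mul_trunc n.+1) // mulrC.
Qed.

Fact ps_mul1 : left_id ps_one ps_mul.
Proof.
move=> f; apply/funext => n; rewrite /ps_mul big_ord_recl /= mul1r subn0.
by rewrite big1 ?addr0 // => i _; rewrite mul0r.
Qed.

Fact ps_mulDl : left_distributive ps_mul ps_add.
Proof.
move=> f g h; apply/funext => n; rewrite /ps_mul /ps_add -big_split /=.
by apply: eq_bigr => i _; rewrite mulrDl.
Qed.

Fact ps_one_neq0 : ps_one != ps_zero.
Proof.
by apply/eqP => /(congr1 (fun f : nat -> R => f 0%N)) /eqP; rewrite oner_eq0.
Qed.

HB.instance Definition _ := GRing.Zmodule_isComNzRing.Build (pser R)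
  ps_mulA ps_mulC ps_mul1 ps_mulDl ps_one_neq0.

Lemma ps_coef0 n : (0 : pser R) n = 0. Proof. by []. Qed.
Lemma ps_coefN f n : (- f) n = - f n. Proof. by []. Qed.
Lemma ps_coefD f g n : (f + g) n = f n + g n. Proof. by []. Qed.
Lemma ps_coefM f g n : (f * g) n = \sum_(i < n.+1) f i * g (n - i)%N.
Proof. by []. Qed.
Lemma ps_coef1 n : (1 : pser R) n = (n == 0)%:R. Proof. by []. Qed.

Definition ps_mono k (a : R) : pser R := fun n => if n == k then a else 0.

Definition ps_const (a : R) : pser R := ps_mono 0 a.

Fact ps_const_is_zmod_morphism : zmod_morphism ps_const.
Proof.
move=> a b; apply/funext => n; rewrite ps_coefD ps_coefN /ps_const /ps_mono.
by case: eqP; rewrite ?subr0.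
Qed.

Fact ps_const_is_monoid_morphism : monoid_morphism ps_const.
Proof.
split=> [|a b]; apply/funext => n.
  by rewrite ps_coef1 /ps_const /ps_mono; case: eqP.
rewrite ps_coefM /ps_const /ps_mono big_ord_recl /= subn0 big1 ?addr0.
  by case: eqP; rewrite ?mulr0.
by move=> i _; rewrite mul0r.
Qed.

HB.instance Definition _ :=
  GRing.isZmodMorphism.Build R (pser R) ps_const ps_const_is_zmod_morphism.
HB.instance Definition _ :=
  GRing.isMonoidMorphism.Build R (pser R) ps_const ps_const_is_monoid_morphism.

Definition ps_coef0th (f : pser R) : R := f 0%N.

Fact ps_coef0th_is_zmod_morphism : zmod_morphism ps_coef0th.
Proof. by []. Qed.

Fact ps_coef0th_is_monoid_morphism : monoid_morphism ps_coef0th.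
Proof.
by split=> // f g; rewrite /ps_coef0th ps_coefM big_ord_recl big_ord0 addr0.
Qed.

HB.instance Definition _ := GRing.isZmodMorphism.Build (pser R) R ps_coef0th
  ps_coef0th_is_zmod_morphism.
HB.instance Definition _ := GRing.isMonoidMorphism.Build (pser R) R ps_coef0th
  ps_coef0th_is_monoid_morphism.

Definition ps_of_poly (p : {poly R}) : pser R := fun n => p`_n.

Fact ps_of_poly_is_zmod_morphism : zmod_morphism ps_of_poly.
Proof.
by move=> p q; apply/funext => n; rewrite ps_coefD ps_coefN /ps_of_poly coefB.
Qed.

Fact ps_of_poly_is_monoid_morphism : monoid_morphism ps_of_poly.
Proof.
split=> [|p q]; apply/funext => n; first by rewrite /ps_of_poly coef1.
by rewrite ps_coefM /ps_of_poly coefM.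
Qed.

HB.instance Definition _ := GRing.isZmodMorphism.Build {poly R} (pser R)
  ps_of_poly ps_of_poly_is_zmod_morphism.
HB.instance Definition _ := GRing.isMonoidMorphism.Build {poly R} (pser R)
  ps_of_poly ps_of_poly_is_monoid_morphism.

Lemma ps_of_poly_inj : injective ps_of_poly.
Proof.
by move=> p q /(congr1 (fun f : nat -> R => f _)) e; apply/polyP => i; apply: e.
Qed.

Lemma ps_of_polyC a : ps_of_poly a%:P = ps_const a.
Proof. by apply/funext => n; rewrite /ps_of_poly coefC. Qed.

Lemma ps_of_poly_horner (p q : {poly R}) :
  ps_of_poly (p \Po q) = (map_poly ps_const p).[ps_of_poly q].
Proof.
elim/poly_ind: p => [|p c IH]; first by rewrite comp_poly0 !rmorph0 horner0.
rewrite comp_polyD comp_polyM comp_polyX comp_polyC !rmorphD !rmorphM /= IH.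
by rewrite map_polyX map_polyC hornerMXaddC ps_of_polyC.
Qed.

(** The ideal of the series divisible by the [k]-th power of the variable. *)
Definition ps_small k f := forall i, (i < k)%N -> f i = 0.

Lemma ps_smallD k f g : ps_small k f -> ps_small k g -> ps_small k (f + g).
Proof. by move=> hf hg i ik; rewrite ps_coefD hf ?hg ?addr0. Qed.

Lemma ps_smallN k f : ps_small k f -> ps_small k (- f).
Proof. by move=> hf i ik; rewrite ps_coefN hf ?oppr0. Qed.

Lemma ps_smallW k l f : (k <= l)%N -> ps_small l f -> ps_small k f.
Proof. by move=> kl hf i ik; apply/hf/(leq_trans ik). Qed.

Lemma ps_smallM k l f g : ps_small k f -> ps_small l g ->
  ps_small (k + l) (f * g) /\ (f * g) (k + l)%N = f k * g l.
Proof.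
move=> hf hg; split=> [i ikl|]; rewrite ps_coefM.
  rewrite big1 // => j _; case: (ltnP j k) => jk; first by rewrite hf ?mul0r.
  by rewrite hg ?mulr0 //; have := ltn_ord j; lia.
have kP : (k < (k + l).+1)%N by rewrite ltnS leq_addr.
rewrite (bigD1 (Ordinal kP)) //= big1 ?addr0.
  by rewrite -[X in g X]/(k + l - k)%N addKn.
move=> j /eqP/val_eqP/= jk; case: (ltnP j k) => jk'; first by rewrite hf ?mul0r.
by rewrite hg ?mulr0 //; have := ltn_ord j; lia.
Qed.

Lemma ps_smallMr k f g : ps_small k g -> ps_small k (f * g).
Proof. by move=> hg; have [] := @ps_smallM 0 k f g _ hg. Qed.

(** Taylor expansion to first order, over any commutative ring: this is all that
    Newton iteration needs. *)
Lemma horner_taylor2 (S : comNzRingType) (p : {poly S}) (x h : S) :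
  exists e, p.[x + h] = p.[x] + p^`().[x] * h + e * h ^+ 2.
Proof.
elim/poly_ind: p => [|p c [e IH]].
  by exists 0; rewrite deriv0 !horner0 !mul0r !addr0.
exists (p^`().[x] + e * (x + h)).
rewrite derivD derivM derivX derivC mulr1 addr0 !hornerMXaddC IH hornerD hornerMX.
ring.
Qed.

End PowerSeries.

(** [R] behaves like a henselian local ring with residue map [res]: simple roots
    in the residue field lift. *)
Definition hensel (K : fieldType) (R : comNzRingType) (res : {rmorphism R -> K}) :=
  forall (p : {poly R}) c, (map_poly res p).[c] = 0 ->
    (map_poly res p)^`().[c] != 0 -> exists2 y, res y = c & p.[y] = 0.

(** An inverse of [u] is a root of [u 'X - 1], whose residual root is simple. *)
Lemma hensel_unit (K : fieldType) (R : comNzRingType) (res : {rmorphism R -> K}) u :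
  hensel res -> res u != 0 -> exists w, u * w = 1.
Proof.
move=> hen u0; have [||w _] := hen (u *: 'X - 1) (res u)^-1.
- by rewrite rmorphB /= map_polyZ /= map_polyX rmorph1 !hornerE divff ?subrr.
- rewrite rmorphB /= map_polyZ /= map_polyX rmorph1 derivB derivZ derivX derivC.
  by rewrite !hornerE subr0.
by rewrite !hornerE => /eqP; rewrite subr_eq0 => /eqP ?; exists w.
Qed.

Section HenselPowerSeries.
Variables (K : fieldType) (R : comNzRingType) (res : {rmorphism R -> K}).
Hypothesis hen : hensel res.

Lemma horner_small_sub k (p : {poly pser R}) (f g : pser R) :
  ps_small k (f - g) -> ps_small k (p.[f] - p.[g]).
Proof.
move=> h; have [e] := @horner_taylor2 _ p g (f - g).
rewrite addrC subrK -addrA => ->; rewrite [X in ps_small _ X]addrC addKr.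
apply: ps_smallD; first exact: ps_smallMr.
by rewrite expr2; do 2![apply: ps_smallMr].
Qed.

(** One step of Newton iteration with the derivative frozen at its constant
    term, whose inverse is [w]: it corrects exactly one coefficient. *)
Lemma hensel_step (p : {poly pser R}) (w : R) k (f : pser R) :
  p^`().[f] 0%N * w = 1 -> ps_small k.+1 p.[f] ->
  ps_small k.+2 p.[f - ps_mono k.+1 (w * p.[f] k.+1)].
Proof.
move=> uw small; set a := w * _; have [e ->] := horner_taylor2 p f (- ps_mono k.+1 a).
have sm : ps_small k.+1 (- ps_mono k.+1 a).
  by move=> i ik; rewrite ps_coefN /ps_mono ltn_eqF // oppr0.
apply: ps_smallD; last first.
  rewrite expr2; apply/ps_smallMr/(@ps_smallW _ _ (k.+1 + k.+1)); first lia.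
  by have [] := ps_smallM sm sm.
have [s0 e0] := @ps_smallM _ 0 k.+1 p^`().[f] _ (fun _ => ltac:(by [])) sm.
move=> i; rewrite ltnS leq_eqVlt => /orP[/eqP ->|ik]; last first.
  by rewrite ps_coefD small // s0 // addr0.
rewrite ps_coefD {}e0 ps_coefN /ps_mono eqxx /a mulrN mulrA uw mul1r.
by rewrite addrN.
Qed.

(** The root is first lifted from the residue field to [R] through the constant
    coefficients, and then one power of the variable at a time. *)
Lemma hensel_pser : hensel (res \o @ps_coef0th R).
Proof.
move=> p c; rewrite map_poly_comp => pc p'c.
have [y0 y0c py0] := hen pc p'c.
have [w uw] : exists w, (map_poly (@ps_coef0th R) p)^`().[y0] * w = 1.
  by apply: (hensel_unit hen); rewrite -horner_map -deriv_map y0c.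
pose Y := fix Y n : pser R := if n is n'.+1 then
  Y n' - ps_mono n (w * p.[Y n'] n) else ps_const y0.
have Y0 n : Y n 0%N = y0.
  by elim: n => [|n IH] //=; rewrite ps_coefD ps_coefN IH /ps_mono subr0.
have hor0 (q : {poly pser R}) n :
    q.[Y n] 0%N = (map_poly (@ps_coef0th R) q).[y0].
  by rewrite -(Y0 n) -[Y n 0%N]/(ps_coef0th (Y n)) horner_map.
have pY n : ps_small n.+1 p.[Y n].
  elim: n => [[|//] _|n IH]; first by rewrite hor0.
  by apply: hensel_step; rewrite ?hor0 -?deriv_map.
have YY n m : (n <= m)%N -> ps_small n.+1 (Y m - Y n).
  elim: m => [|m IH]; first by case: n => // _ i; rewrite subrr.
  rewrite leq_eqVlt => /orP[/eqP ->|]; first by move=> i; rewrite subrr.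
  rewrite ltnS => nm /=; rewrite addrAC; apply: ps_smallD; first exact: IH.
  by apply: ps_smallN => i i_n; rewrite /ps_mono ltn_eqF //; lia.
(* The approximations stabilize coefficientwise; [y] is their limit. *)
pose y : pser R := fun n => Y n n.
have yY n : ps_small n.+1 (y - Y n).
  move=> i; rewrite ltnS => i_n; have := @YY i n i_n i (ltnSn _).
  rewrite !ps_coefD !ps_coefN /y => /eqP; rewrite subr_eq0 => /eqP ->.
  by rewrite subrr.
exists y; first by rewrite /= /ps_coef0th /y Y0.
apply/funext => n.
have /(_ n (ltnSn _)) := horner_small_sub p (yY n).
by rewrite ps_coefD ps_coefN (pY n n (ltnSn _)) subr0.
Qed.

End HenselPowerSeries.

(** * Leading terms of iterated power series *)

(** Only the values at the indices below the number [d] of variables matter; total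
    functions keep one type of exponents for all [d]. *)
Definition expt := nat -> nat.

Definition expt_add (u v : expt) : expt := fun i => (u i + v i)%N.
Definition expt_delta (i : nat) : expt := fun j => (j == i).

Definition expt_eq (d : nat) (u v : expt) := forall i, (i < d)%N -> u i = v i.

(** Lexicographic order, in which the last variable is the most significant. *)
Definition expt_lt (d : nat) (u v : expt) :=
  exists k, [/\ (k < d)%N, (u k < v k)%N
    & forall j, (k < j)%N -> (j < d)%N -> u j = v j].

Lemma expt_trichotomy d u v : [\/ expt_eq d u v, expt_lt d u v | expt_lt d v u].
Proof.
elim: d => [|d IH]; first by constructor 1.
case: (ltngtP (u d) (v d)) => [uv|vu|uv].
- by constructor 2; exists d; split=> // j dj; rewrite ltnS leqNgt dj.
- by constructor 3; exists d; split=> // j dj; rewrite ltnS leqNgt dj.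
have top w z : w d = z d -> forall k,
    (forall j, (k < j)%N -> (j < d)%N -> w j = z j) ->
    forall j, (k < j)%N -> (j < d.+1)%N -> w j = z j.
  move=> wz k h j kj; rewrite ltnS leq_eqVlt => /orP[/eqP -> //|]; exact: h.
case: IH => [e|[k [kd uvk h]]|[k [kd uvk h]]].
- constructor 1 => i; rewrite ltnS leq_eqVlt => /orP[/eqP -> //|]; exact: e.
- by constructor 2; exists k; split=> //; [exact: ltnW|exact: top].
- by constructor 3; exists k; split=> //; [exact: ltnW|exact: top].
Qed.

(** A ring of power series in [d] variables over [K], reduced to what the place
    needs. The two last operations describe expansions in monomials ordered
    lexicographically: [lr_small u a] says that [a] has no monomial below
    exponent [u], and [lr_coef u a] is then its coefficient at [u]. A nonzero
    series has a leading exponent, and leading coefficients are multiplicative;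
    this makes [lr_coef] at the leading exponent the substitute for a valuation
    with values in the lexicographic power of the integers. *)
Record lexring (K : fieldType) (d : nat) := LexRing {
  lr_ring :> comNzRingType;
  lr_emb : {rmorphism K -> lr_ring};
  lr_res : {rmorphism lr_ring -> K};
  lr_var : nat -> lr_ring;
  lr_small : expt -> lr_ring -> Prop;
  lr_coef : expt -> lr_ring -> K;
  lr_embK : forall a, lr_res (lr_emb a) = a;
  lr_hensel : hensel lr_res;
  lr_ext : forall u v a, expt_eq d u v -> lr_small u a ->
    lr_small v a /\ lr_coef v a = lr_coef u a;
  lr_lt : forall u v a, expt_lt d u v -> lr_small v a ->
    lr_small u a /\ lr_coef u a = 0;
  lr_zero : forall u, lr_small u 0 /\ lr_coef u 0 = 0;
  lr_add : forall u a b, lr_small u a -> lr_small u b ->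
    lr_small u (a + b) /\ lr_coef u (a + b) = lr_coef u a + lr_coef u b;
  lr_mul : forall u v a b, lr_small u a -> lr_small v b ->
    lr_small (expt_add u v) (a * b) /\
    lr_coef (expt_add u v) (a * b) = lr_coef u a * lr_coef v b;
  lr_const : forall a, lr_small (fun=> 0%N) a /\ lr_coef (fun=> 0%N) a = lr_res a;
  lr_lead : forall a, a <> 0 -> exists u, lr_small u a /\ lr_coef u a <> 0;
  lr_varP : forall i, (i < d)%N -> lr_small (expt_delta i) (lr_var i) /\
    lr_coef (expt_delta i) (lr_var i) = 1 }.

(** Transparent, so that its ring computes to [K]. *)
Lemma lexring0 (K : fieldType) : lexring K 0.
Proof.
refine (@LexRing K 0 K idfun idfun (fun=> 0) (fun _ _ => True) (fun _ a => a)
  _ _ _ _ _ _ _ _ _ _) => //.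
- by move=> p c; rewrite map_poly_id // => pc _; exists c.
- by move=> u v a [k []].
- by move=> a a0; exists (fun=> 0%N).
Defined.

Section LexRingStep.
Variables (K : fieldType) (d : nat) (R : lexring K d).

(** Series over [R] in one more variable: the expansion is first ordered by the
    exponent of the new variable. *)
Definition lexS_small (u : expt) (f : pser R) :=
  ps_small (u d) f /\ lr_small u (f (u d)).

Definition lexS_coef (u : expt) (f : pser R) := lr_coef u (f (u d)).

Definition lexS_var i : pser R :=
  if i == d then ps_mono 1 1 else ps_const (lr_var R i).

Lemma lexS_ext u v (a : pser R) : expt_eq d.+1 u v -> lexS_small u a ->
    lexS_small v a /\ lexS_coef v a = lexS_coef u a.
Proof.
move=> e [s1 s2]; rewrite /lexS_small /lexS_coef -(e d (ltnSn _)).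
have [i id|s3 ->] := lr_ext (v := v) _ s2; last by [].
by apply: e; exact: ltnW.
Qed.

Lemma lexS_lt u v (a : pser R) : expt_lt d.+1 u v -> lexS_small v a ->
    lexS_small u a /\ lexS_coef u a = 0.
Proof.
move=> [k [kd uvk h]] [s1 s2].
move: kd; rewrite ltnS leq_eqVlt => /orP[/eqP kd|kd].
  subst k; rewrite /lexS_small /lexS_coef s1 //; have [z ->] := lr_zero R u.
  by split=> //; split=> //; apply: ps_smallW s1; apply: ltnW.
have e : u d = v d by apply: h.
rewrite /lexS_small /lexS_coef e.
have [|s3 ->] := lr_lt (u := u) _ s2; last by [].
by exists k; split=> // j kj jd; apply: h => //; apply: ltnW.
Qed.

Lemma lexS_zero u : lexS_small u 0 /\ lexS_coef u 0 = 0.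
Proof.
by rewrite /lexS_small /lexS_coef ps_coef0; have [z ->] := lr_zero R u.
Qed.

Lemma lexS_add u (a b : pser R) : lexS_small u a -> lexS_small u b ->
  lexS_small u (a + b) /\ lexS_coef u (a + b) = lexS_coef u a + lexS_coef u b.
Proof.
move=> [a1 a2] [b1 b2]; have [s e] := lr_add a2 b2.
by split=> //; split=> //; apply: ps_smallD.
Qed.

Lemma lexS_mul u v (a b : pser R) : lexS_small u a -> lexS_small v b ->
  lexS_small (expt_add u v) (a * b) /\
  lexS_coef (expt_add u v) (a * b) = lexS_coef u a * lexS_coef v b.
Proof.
move=> [a1 a2] [b1 b2]; have [s e] := lr_mul a2 b2.
have [s' e'] := ps_smallM a1 b1.
by rewrite /lexS_small /lexS_coef /= e'.
Qed.

Lemma lexS_const (a : pser R) : lexS_small (fun=> 0%N) a /\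
  lexS_coef (fun=> 0%N) a = (@lr_res K d R \o @ps_coef0th R) a.
Proof. by have [s e] := lr_const (a 0%N). Qed.

Lemma lexS_lead (a : pser R) :
  a <> 0 -> exists u, lexS_small u a /\ lexS_coef u a <> 0.
Proof.
move=> a0; have [n an0] : exists n, a n != 0.
  apply: contra_notP a0 => /forallNP h; apply/funext => n; apply/eqP.
  by apply: contraT => /h.
have [k ak0 kmin] := ex_minnP (ex_intro (fun n => a n != 0) n an0).
have [u [su cu]] := lr_lead (elimN eqP ak0).
pose v i := if i == d then k else u i.
have e : expt_eq d u v by move=> i; rewrite /v => /ltn_eqF ->.
have [sv cv] := lr_ext e su.
have vd : v d = k by rewrite /v eqxx.
exists v; rewrite /lexS_small /lexS_coef vd cv; split=> //.
split=> // i ik; apply/eqP/contraT => /kmin; by rewrite leqNgt ik.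
Qed.

Lemma lexS_varP i : (i < d.+1)%N ->
  lexS_small (expt_delta i) (lexS_var i) /\
  lexS_coef (expt_delta i) (lexS_var i) = 1.
Proof.
rewrite /lexS_small /lexS_coef /lexS_var ltnS leq_eqVlt /expt_delta.
case: eqP => [-> _|/eqP nid] /=.
  rewrite eqxx /ps_mono /=; have [s e] := lr_const (1 : R).
  have z : expt_eq d (fun=> 0%N) (expt_delta d).
    by move=> j jd; rewrite /expt_delta ltn_eqF.
  have [s' e'] := lr_ext z s; rewrite [LHS]e' e rmorph1.
  by split=> //; split=> //; case.
move=> id; rewrite eq_sym (negbTE nid) /=.
by have [s e] := lr_varP R id; split=> //; split.
Qed.

Definition lexringS : lexring K d.+1 :=
  @LexRing K d.+1 (pser R) (@ps_const R \o @lr_emb K d R)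
    (@lr_res K d R \o @ps_coef0th R) lexS_var lexS_small lexS_coef
    (@lr_embK _ _ R) (hensel_pser (@lr_hensel _ _ R))
    lexS_ext lexS_lt lexS_zero lexS_add lexS_mul lexS_const lexS_lead lexS_varP.

End LexRingStep.

Fixpoint power_series (K : fieldType) (d : nat) : lexring K d :=
  if d is d'.+1 then lexringS (power_series K d') else lexring0 K.

Section LexRingTheory.
Variables (K : fieldType) (d : nat) (R : lexring K d).
Implicit Types (a b : R) (u v : expt).

Definition lr_exact u a := lr_small u a /\ lr_coef u a <> 0.

Lemma lr_exact_neq0 u a : lr_exact u a -> a <> 0.
Proof. by case=> _ h a0; apply: h; rewrite a0; have [] := lr_zero R u. Qed.

Lemma lr_exactM u v a b :
  lr_exact u a -> lr_exact v b -> lr_exact (expt_add u v) (a * b).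
Proof.
move=> [sa ca] [sb cb]; have [s c] := lr_mul sa sb; split=> //.
by rewrite c => /eqP; rewrite mulf_eq0 => /orP[] /eqP.
Qed.

Lemma lr_neq0M a b : a <> 0 -> b <> 0 -> a * b <> 0.
Proof.
move=> /lr_lead[u au] /lr_lead[v bv]; exact: lr_exact_neq0 (lr_exactM au bv).
Qed.

Lemma lr_exact1 : lr_exact (fun=> 0%N) (1 : R).
Proof.
by have [s e] := lr_const (1 : R); split=> //; rewrite e rmorph1; apply/eqP/oner_neq0.
Qed.

Lemma lr_exactX u a n : lr_exact u a -> lr_exact (fun i => n * u i)%N (a ^+ n).
Proof.
move=> ua; elim: n => [|n IH]; first by rewrite expr0; apply: lr_exact1.
by rewrite exprS; apply: lr_exactM ua IH.
Qed.

Lemma lr_exact_var i : (i < d)%N -> lr_exact (expt_delta i) (lr_var R i).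
Proof.
by move=> /(lr_varP R)[s e]; split=> //; rewrite e; apply/eqP/oner_neq0.
Qed.

Lemma lr_exact_monomial u :
  lr_exact u (\prod_(i < d) lr_var R i ^+ u i).
Proof.
have h n : (n <= d)%N -> lr_exact (fun i => if (i < n)%N then u i else 0%N)
    (\prod_(i < n) lr_var R i ^+ u i).
  elim: n => [_|n IH nd]; first by rewrite big_ord0; apply: lr_exact1.
  rewrite big_ord_recr /=.
  have := lr_exactM (IH (ltnW nd)) (lr_exactX (u n) (lr_exact_var nd)).
  congr lr_exact; apply/funext => i; rewrite /expt_add /expt_delta ltnS.
  by case: ltngtP => [||->]; rewrite ?muln0 ?muln1 ?addn0.
have [s c] := h d (leqnn d).
have e : expt_eq d (fun i => if (i < d)%N then u i else 0%N) u by move=> i ->.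
by have [s' c'] := lr_ext e s; split=> //; rewrite c'.
Qed.

End LexRingTheory.

(** * Convex subgroups of a group with generators of different sizes *)

Section RankOfGenerators.
Local Open Scope classical_set_scope.
Local Open Scope card_scope.
Variables (G : porderZmodType) (d : nat) (g : nat -> G).
Hypothesis tot : forall x y : G, (x <= y) || (y <= x).
Hypothesis mon : forall x y z : G, x <= y -> x + z <= y + z.
Hypothesis g_gt0 : forall i, (i < d)%N -> 0 < g i.
Hypothesis g_lt : forall i j n, (i < j)%N -> (j < d)%N -> g i *+ n < g j.
Hypothesis g_gen : forall x, exists a : nat -> int, x = \sum_(i < d) g i *~ a i.

Let ltN (x y : G) : ~~ (x < y) = (y <= x).
Proof.
apply/idP/idP => [|yx]; last by apply/negP => /lt_le_trans /(_ yx); rewrite ltxx.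
by rewrite lt_neqAle negb_and negbK => /orP[/eqP -> //|]; have /orP[->|] := tot x y.
Qed.

Let monD (x y z t : G) : x <= y -> z <= t -> x + z <= y + t.
Proof.
by move=> xy zt; apply: (le_trans (mon z xy)); rewrite ![y + _]addrC; apply: mon.
Qed.

Let monlD (x y z t : G) : x < y -> z <= t -> x + z < y + t.
Proof.
move=> xy zt; rewrite lt_neqAle monD ?(ltW xy) // andbT.
apply/eqP => e; have: y + t <= x + t by rewrite -e ![x + _]addrC; apply: mon.
by move=> /(mon (- t)); rewrite !addrK -ltN xy.
Qed.

Let monMn (x y : G) n : x <= y -> x *+ n <= y *+ n.
Proof. by move=> xy; elim: n => [|n IH]; rewrite ?mulr0n // !mulrS monD. Qed.

Definition infinitesimals k : set G :=
  [set x | forall n, x *+ n < g k /\ (- x) *+ n < g k].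

(** Closure under subtraction: if [n] times the difference exceeded [g k], then
    one of the two multiples by [2 n] would exceed it as well. *)
Lemma infinitesimals_convex k : (k < d)%N -> convex_subgroup (infinitesimals k).
Proof.
move=> kd; split.
- by move=> n; rewrite oppr0 mul0rn; split; apply: g_gt0.
- have main x y n : infinitesimals k x -> infinitesimals k y ->
    (x - y) *+ n < g k.
    move=> hx hy; rewrite -[_ < _]negbK ltN; apply/negP => le.
    have [h _] := hx (n.*2); have [_ h'] := hy (n.*2).
    have := monlD h (ltW h'); rewrite -mulrnDl -mul2n mulnC mulrnA.
    by rewrite mulr2n => h2; have := lt_le_trans h2 (monD le le); rewrite ltxx.
  move=> x y hx hy n; split; first exact: main.
  by rewrite opprB; apply: main.
move=> x y z hx hz xy yz n; split.
  by apply: (le_lt_trans (monMn n yz)); have [] := hz n.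
have: - y <= - x by have := mon (- x - y) xy; rewrite addrA subrr sub0r addrCA subrr addr0.
by move=> h; apply: (le_lt_trans (monMn n h)); have [] := hx n.
Qed.

Lemma infinitesimals_gen i k : (i < k)%N -> (k < d)%N -> infinitesimals k (g i).
Proof.
move=> ik kd n; split; first exact: g_lt.
apply: (@le_lt_trans _ _ 0); last exact: g_gt0.
rewrite mulNrn; have := monMn n (ltW (g_gt0 (ltn_trans ik kd))).
by rewrite mul0rn => /(mon (- (g i *+ n))); rewrite subrr sub0r.
Qed.

Lemma infinitesimals_genN k : ~ infinitesimals k (g k).
Proof. by move=> /(_ 1%N)[]; rewrite ltxx. Qed.

Section Subgroup.
Variable H : set G.
Hypothesis Hc : convex_subgroup H.

Lemma convex_subgroupN x : H x -> H (- x).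
Proof. by case: Hc => h0 hB _ hx; rewrite -sub0r; apply: hB. Qed.

Lemma convex_subgroupD x y : H x -> H y -> H (x + y).
Proof.
by case: Hc => h0 hB _ hx hy; rewrite -[y]opprK; apply: hB => //; apply: convex_subgroupN.
Qed.

Lemma convex_subgroupMn x n : H x -> H (x *+ n).
Proof.
case: (Hc) => h0 _ _ hx; elim: n => [|n IH] //.
by rewrite mulrS; apply: convex_subgroupD.
Qed.

Lemma convex_subgroupMz x (m : int) : H x -> H (x *~ m).
Proof.
move=> hx; case: m => n; first exact: convex_subgroupMn.
by rewrite NegzE mulrNz; apply/convex_subgroupN/convex_subgroupMn.
Qed.

Lemma convex_subgroup_sum m (a : nat -> int) :
  (forall i, (i < m)%N -> H (g i)) -> H (\sum_(i < m) g i *~ a i).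
Proof.
elim: m => [|m IH] h; first by rewrite big_ord0; case: Hc.
rewrite big_ord_recr /=; apply: convex_subgroupD; last exact/convex_subgroupMz/h.
by apply: IH => i im; apply/h/ltnW.
Qed.

End Subgroup.

(** If the top coefficient of a combination is positive, then twice the
    combination exceeds its last generator, since the lower terms are infinitely
    small with respect to that generator. *)
Lemma positive_top_large j k (l : G) (m : nat) : (k <= j)%N -> (j < d)%N ->
  infinitesimals j l -> ~ infinitesimals k (l + g j *+ m.+1).
Proof.
move=> kj jd lj hk; have [h _] := hk 2%N; have [_ h'] := lj 2%N.
have gkj : g k <= g j.
  move: kj; rewrite leq_eqVlt => /orP[/eqP -> //|kj].
  by have := g_lt 1 kj jd; rewrite mulr1n; apply: ltW.
have gm : g j <= g j *+ m.+1.
  rewrite mulrS -[X in X <= _]addr0; apply: monD => //.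
  by have := monMn m (ltW (g_gt0 jd)); rewrite mul0rn.
have := monlD (lt_le_trans h gkj) (ltW h').
rewrite mulrnDl mulNrn addrAC subrr add0r => /lt_le_trans /(_ (monD gm gm)).
by rewrite mulr2n ltxx.
Qed.

(** By the previous lemma an infinitesimal combination involves only the generators
    below [g k]. *)
Lemma infinitesimals_sub (H : set G) k m (a : nat -> int) :
  (k < d)%N -> (m <= d)%N -> convex_subgroup H ->
  (forall i, (i < k)%N -> H (g i)) ->
  infinitesimals k (\sum_(i < m) g i *~ a i) -> H (\sum_(i < m) g i *~ a i).
Proof.
move=> kd md Hc Hg; elim: m md => [|m IH] md hk.
  by rewrite big_ord0; case: Hc.
case: (ltnP m k) => mk.
  by apply: (convex_subgroup_sum Hc) => i im; apply/Hg/(leq_trans im).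
have cm := infinitesimals_convex md.
have lm : infinitesimals m (\sum_(i < m) g i *~ a i).
  by apply: (convex_subgroup_sum cm) => i im; apply: infinitesimals_gen.
move: hk; rewrite big_ord_recr /=; case: (a m) => [[|n]|n].
- by rewrite mulr0z addr0; apply: IH; apply: ltnW.
- by move=> hk; case: (positive_top_large mk md lm hk).
move=> hk; exfalso; have ck := infinitesimals_convex kd.
have := convex_subgroupN ck hk; rewrite opprD NegzE mulrNz opprK.
exact: positive_top_large mk md (convex_subgroupN cm lm).
Qed.

(** [k] is the index of the first generator outside [H]. *)
Lemma convex_proper_infinitesimals (H : set G) :
  convex_subgroup H -> H <> setT ->
  exists2 k, (k < d)%N & H = infinitesimals k.
Proof.
move=> Hc HT.
have ex : exists k, (k < d)%N && `[< ~ H (g k) >].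
  apply: contra_notP HT => /forallNP h; apply/seteqP; split=> // x _.
  have [a ->] := g_gen x; apply: (convex_subgroup_sum Hc) => i id.
  apply: contrapT => nH; apply: (h i); rewrite id /=; exact/asboolP.
have [k /andP[kd /asboolP nHk] kmin] := ex_minnP ex.
have Hlt i : (i < k)%N -> H (g i).
  move=> ik; apply: contrapT => nH; have: (k <= i)%N.
    by apply: kmin; rewrite (ltn_trans ik kd); apply/asboolP.
  by rewrite leqNgt ik.
exists k => //; apply/seteqP; split=> x.
  have small y : H y -> y < g k.
    move=> hy; rewrite -[_ < _]negbK ltN; apply/negP => le; apply: nHk.
    by case: Hc => h0 _ hconv; apply: hconv h0 hy (ltW (g_gt0 kd)) le.
  move=> hx n; split; apply: small; apply: (convex_subgroupMn Hc) => //.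
  exact: (convex_subgroupN Hc).
have [a xE] := g_gen x; rewrite {x}xE.
exact: infinitesimals_sub.
Qed.

(** If the generators are each infinitely larger than the preceding ones, then the
    proper convex subgroups are exactly the [d] groups of infinitesimals. *)
Lemma rank_of_generators : has_rank G d.
Proof.
rewrite /has_rank; have -> : [set H : set G | convex_subgroup H /\ H <> setT] =
    infinitesimals @` `I_d.
  apply/seteqP; split=> H /=.
    by move=> [hc hT]; have [k kd ->] := convex_proper_infinitesimals hc hT; exists k.
  move=> [k kd <-]; split; first exact: infinitesimals_convex.
  by move=> e; apply: (@infinitesimals_genN k); rewrite e.
apply: inj_card_eq => k l; rewrite !inE /= => kd ld e.
case: (ltngtP k l) => // kl; exfalso.
  by apply: (@infinitesimals_genN k); rewrite e; apply: infinitesimals_gen.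
by apply: (@infinitesimals_genN l); rewrite -e; apply: infinitesimals_gen.
Qed.

End RankOfGenerators.

(** * The place given by leading terms *)

Section Valuation.
Variables (F L : fieldType) (P : place F L).

Definition valuation (x : F) : value_group P :=
  val_of P (insubd (nz_one F) x).

Lemma val_insubd (x : F) : x != 0 -> val (insubd (nz_one F) x) = x.
Proof. by move=> x0; rewrite val_insubd x0. Qed.

Lemma valuationM x y : x != 0 -> y != 0 ->
  valuation (x * y) = valuation x + valuation y.
Proof.
move=> x0 y0; rewrite /valuation [RHS]vaddE; congr val_of; apply: val_inj.
by rewrite [RHS]/= !val_insubd ?mulf_neq0.
Qed.

Lemma valuation1 : valuation 1 = 0.
Proof.
by congr val_of; apply: val_inj; rewrite val_insubd ?oner_neq0.
Qed.

Lemma valuationX x n : x != 0 -> valuation (x ^+ n) = valuation x *+ n.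
Proof.
move=> x0; elim: n => [|n IH]; first by rewrite expr0 valuation1.
by rewrite exprS valuationM ?expf_neq0 // IH mulrS.
Qed.

Lemma valuation_prod n (x : nat -> F) (u : nat -> nat) :
  (forall i, (i < n)%N -> x i != 0) ->
  valuation (\prod_(i < n) x i ^+ u i) = \sum_(i < n) valuation (x i) *+ u i.
Proof.
elim: n => [|n IH] x0; first by rewrite !big_ord0 valuation1.
rewrite !big_ord_recr /= valuationM ?valuationX ?IH ?expf_neq0 ?x0 //.
  by move=> i i_n; apply/x0/ltnW.
apply/prodf_neq0 => i _; rewrite expf_neq0 ?x0 //; exact: ltnW (ltn_ord i).
Qed.

Lemma valuation_le x y : x != 0 -> y != 0 ->
  (valuation x <= valuation y) = finite_on P (y / x).
Proof. by move=> x0 y0; rewrite [LHS]vleE /val_le !val_insubd. Qed.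

Lemma valuation_surj (v : value_group P) : exists2 x, x != 0 & v = valuation x.
Proof.
exists (val (repr v)); first exact: (valP (repr v)).
rewrite -[LHS]val_ofK; congr val_of; apply: val_inj.
by rewrite val_insubd ?(valP (repr v)).
Qed.

Lemma valuation_lt x y : x != 0 -> y != 0 -> P (y / x) = Some 0 ->
  valuation x < valuation y.
Proof.
move=> x0 y0 p; rewrite lt_neqAle valuation_le // /finite_on p andbT.
apply/eqP => e; have: finite_on P (x / y) by rewrite -valuation_le // e.
rewrite /finite_on; case exy: (P (x / y)) => [a|//] _.
have := placeM p exy; rewrite -[x / y]invf_div mulfV.
  by rewrite place1 mul0r => -[] /eqP; rewrite oner_eq0.
by rewrite mulf_neq0 ?invr_eq0.
Qed.

End Valuation.

Section PlaceOfEmbedding.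
Variables (K F : fieldType) (iota : {rmorphism K -> F}).
Variables (d : nat) (R : lexring K d) (B : comNzRingType).
Variables (kappa : {rmorphism K -> B}) (ev : {rmorphism B -> F}).
Variable (rho : {rmorphism B -> R}).
Hypothesis ev_kappa : forall a, ev (kappa a) = iota a.
Hypothesis rho_kappa : forall a, rho (kappa a) = lr_emb R a.
Hypothesis same_ker : forall f, rho f = 0 <-> ev f = 0.
Hypothesis ev_frac : forall x, exists a b, ev b <> 0 /\ x = ev a / ev b.

(** The place induced on [F] by the leading terms of the series [rho b]: a quotient
    whose numerator starts no earlier than its denominator is sent to the quotient
    of the coefficients at the leading exponent of the denominator. *)
Definition leading_value (x : F) (c : K) := exists a b u,
  [/\ x = ev a / ev b, lr_small u (rho a), lr_exact u (rho b)
    & c = lr_coef u (rho a) / lr_coef u (rho b)].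

Lemma ev_exact_neq0 u b : lr_exact u (rho b) -> ev b != 0.
Proof. by move=> /lr_exact_neq0 h; apply/eqP => /same_ker. Qed.

Lemma leading_value_uniq x c c' :
  leading_value x c -> leading_value x c' -> c = c'.
Proof.
move=> [a [b [u [xE sa eb ->]]]] [a' [b' [u' [xE' sa' eb' ->]]]].
have b0 := ev_exact_neq0 eb; have b'0 := ev_exact_neq0 eb'.
have e : rho (a * b') = rho (a' * b).
  apply/eqP; rewrite -subr_eq0 -rmorphB; apply/eqP/same_ker/eqP.
  by rewrite rmorphB subr_eq0 !rmorphM -eqr_div // -xE xE'.
have [sb cb] := eb; have [sb' cb'] := eb'.
have [_ m1] := lr_mul sa sb'; have [_ m2] := lr_mul sa' sb.
have uu : expt_add u' u = expt_add u u' by apply/funext => i; apply: addnC.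
apply/eqP; rewrite eqr_div; try by apply/eqP.
by rewrite -m1 -m2 -!rmorphM e uu.
Qed.

Lemma leading_value_exact a u b v x : x = ev a / ev b ->
  lr_exact u (rho a) -> lr_exact v (rho b) -> expt_lt d v u ->
  leading_value x 0.
Proof.
move=> xE [sa _] eb vu; have [s c] := lr_lt vu sa.
by exists a, b, v; split=> //; rewrite c mul0r.
Qed.

Lemma leading_value_ev a : leading_value (ev a) (lr_res R (rho a)).
Proof.
have [s c] := lr_const (rho a); have [s1 c1] := lr_const (1 : R).
exists a, 1, (fun=> 0%N); split=> //; first by rewrite rmorph1 divr1.
  by rewrite rmorph1; apply: lr_exact1.
by rewrite rmorph1 c c1 rmorph1 divr1.
Qed.

Lemma leading_valueD x y c e : leading_value x c -> leading_value y e ->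
  leading_value (x + y) (c + e).
Proof.
move=> [a [b [u [-> sa eb ->]]]] [a' [b' [u' [-> sa' eb' ->]]]].
have b0 := ev_exact_neq0 eb; have b'0 := ev_exact_neq0 eb'.
have [sb cb] := eb; have [sb' cb'] := eb'.
have [s1 m1] := lr_mul sa sb'; have [s2 m2] := lr_mul sa' sb.
have uu : expt_add u' u = expt_add u u' by apply/funext => i; apply: addnC.
rewrite uu in s2 m2; have [s3 m3] := lr_add s1 s2.
have [_ m4] := lr_mul sb sb'.
exists (a * b' + a' * b), (b * b'), (expt_add u u'); split.
- by rewrite addf_div // rmorphD !rmorphM.
- by rewrite rmorphD !rmorphM.
- by rewrite rmorphM; apply: lr_exactM.
rewrite rmorphD !rmorphM m3 m1 m2 m4 addf_div //; exact/eqP.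
Qed.

Lemma leading_valueM x y c e : leading_value x c -> leading_value y e ->
  leading_value (x * y) (c * e).
Proof.
move=> [a [b [u [-> sa eb ->]]]] [a' [b' [u' [-> sa' eb' ->]]]].
have [sb cb] := eb; have [sb' cb'] := eb'.
have [s1 m1] := lr_mul sa sa'; have [_ m2] := lr_mul sb sb'.
exists (a * a'), (b * b'), (expt_add u u').
rewrite !rmorphM !mulf_div m1 m2; split=> //; exact: lr_exactM.
Qed.

(** If [x] has no value, the leading exponent of its numerator is strictly below that
    of its denominator, because the order is total. *)
Lemma leading_valueV x : ~ (exists c, leading_value x c) ->
  leading_value x^-1 0.
Proof.
have [a [b [b0 xE]]] := ev_frac x => nx.
have a0 : ev a <> 0.
  move=> a0; apply: nx; exists (lr_res R (rho 0)).
  by rewrite xE a0 mul0r -(rmorph0 ev); apply: leading_value_ev.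
have [u ea] := lr_lead (fun h => a0 ((same_ker a).1 h)).
have [v eb] := lr_lead (fun h => b0 ((same_ker b).1 h)).
have [e|uv|vu] := expt_trichotomy d u v.
- case: nx; exists (lr_coef v (rho a) / lr_coef v (rho b)), a, b, v; split=> //.
  by have [] := lr_ext e ea.1.
- by apply: leading_value_exact eb ea uv; rewrite xE invf_div.
by case: nx; exists 0; apply: leading_value_exact ea eb vu.
Qed.

Definition lex_place_fun (x : F) : option K :=
  if pselect (exists c, leading_value x c) is left h
  then Some (sval (cid h)) else None.

Lemma lex_place_funP x c : lex_place_fun x = Some c <-> leading_value x c.
Proof.
rewrite /lex_place_fun; case: pselect => h; last first.
  by split=> // hc; case: h; exists c.
split=> [[<-]|hc]; first exact: svalP (cid h).
by congr Some; apply: leading_value_uniq (svalP (cid h)) hc.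
Qed.

Fact lex_place1 : lex_place_fun 1 = Some 1.
Proof.
by apply/lex_place_funP; have := leading_value_ev 1; rewrite !rmorph1.
Qed.

Fact lex_placeD x y a b : lex_place_fun x = Some a -> lex_place_fun y = Some b ->
  lex_place_fun (x + y) = Some (a + b).
Proof. by rewrite !lex_place_funP; apply: leading_valueD. Qed.

Fact lex_placeM x y a b : lex_place_fun x = Some a -> lex_place_fun y = Some b ->
  lex_place_fun (x * y) = Some (a * b).
Proof. by rewrite !lex_place_funP; apply: leading_valueM. Qed.

Fact lex_placeV x : lex_place_fun x = None -> lex_place_fun x^-1 = Some 0.
Proof.
rewrite lex_place_funP => xN; apply: leading_valueV => -[c].
by rewrite -lex_place_funP xN.
Qed.

Definition lex_place : place F K := Place lex_place1 lex_placeD lex_placeM lex_placeV.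

Fact lex_place_id a : lex_place (iota a) = Some (idfun a).
Proof.
apply/lex_place_funP; have := leading_value_ev (kappa a).
by rewrite ev_kappa rho_kappa lr_embK.
Qed.

Definition lex_fplace : fplace iota := FPlace lex_place_id.

Lemma lex_place_ev b : lex_place (ev b) = Some (lr_res R (rho b)).
Proof. by apply/lex_place_funP/leading_value_ev. Qed.

Lemma lex_fplace_rational : rational_place lex_fplace.
Proof.
rewrite /rational_place; apply/seteqP; split=> a /= _; first by exists a.
by exists (iota a); rewrite lex_place_id.
Qed.

Lemma finite_on_eq u a b :
  lr_exact u (rho a) -> lr_exact u (rho b) -> finite_on lex_place (ev a / ev b).
Proof.
move=> [sa _] eb; rewrite /finite_on /=.
suff /lex_place_funP -> :
  leading_value (ev a / ev b) (lr_coef u (rho a) / lr_coef u (rho b)) by [].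
by exists a, b, u.
Qed.

Variable T : nat -> B.
Hypothesis rhoT : forall i, (i < d)%N -> rho (T i) = lr_var R i.

Lemma exactT i : (i < d)%N -> lr_exact (expt_delta i) (rho (T i)).
Proof. by move=> id; rewrite rhoT //; apply: lr_exact_var. Qed.

Lemma evT_neq0 i : (i < d)%N -> ev (T i) != 0.
Proof. by move=> /exactT/ev_exact_neq0. Qed.

Lemma lex_place_lt a u b v : lr_exact u (rho a) -> lr_exact v (rho b) ->
  expt_lt d u v ->
  valuation lex_place (ev a) < valuation lex_place (ev b).
Proof.
move=> ea eb uv; apply: valuation_lt; try exact: (ev_exact_neq0 ea).
  exact: (ev_exact_neq0 eb).
by apply/lex_place_funP; apply: leading_value_exact eb ea uv.
Qed.

(** A series and the monomial with the same leading exponent differ by a unit of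
    the valuation ring. *)
Lemma lex_place_exact a u : lr_exact u (rho a) ->
  valuation lex_place (ev a) =
  \sum_(i < d) valuation lex_place (ev (T i)) *+ u i.
Proof.
move=> ea; pose m := \prod_(i < d) T i ^+ u i.
have em : lr_exact u (rho m).
  rewrite rmorph_prod (eq_bigr (fun i : 'I_d => lr_var R i ^+ u i)).
    exact: lr_exact_monomial.
  by move=> i _; rewrite rmorphXn rhoT.
rewrite -(@valuation_prod _ _ _ _ (fun i => ev (T i))); last exact: evT_neq0.
have -> : \prod_(i < d) ev (T i) ^+ u i = ev m.
  by rewrite rmorph_prod; apply: eq_bigr => i _; rewrite rmorphXn.
apply/le_anti/andP; split.
  rewrite valuation_le ?(ev_exact_neq0 ea) ?(ev_exact_neq0 em) //.
  exact: finite_on_eq em ea.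
rewrite valuation_le ?(ev_exact_neq0 ea) ?(ev_exact_neq0 em) //.
exact: finite_on_eq ea em.
Qed.

(** The values of the [T i] generate the value group, by the description of leading
    exponents, and each is infinitely larger than the preceding ones because the
    exponents are ordered lexicographically. *)
Lemma lex_place_rank : has_rank (value_group lex_place) d.
Proof.
apply: (@rank_of_generators _ d (fun i => valuation lex_place (ev (T i)))).
- by move=> x y; apply: le_total.
- exact: value_group_leD.
- move=> i id; rewrite -(valuation1 lex_place) -(rmorph1 ev).
  apply: (@lex_place_lt _ (fun=> 0%N) _ (expt_delta i)); last first.
  + exists i; rewrite /expt_delta eqxx; split=> // j ij _.
    by rewrite gtn_eqF.
  + exact: exactT.
  + by rewrite rmorph1; apply: lr_exact1.
- move=> i j n ij jd; rewrite -valuationX ?evT_neq0 ?(ltn_trans ij) //.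
  rewrite -rmorphXn; have := lr_exactX n (exactT (ltn_trans ij jd)).
  rewrite -rmorphXn => e; apply: lex_place_lt e (exactT jd) _.
  exists j; rewrite /expt_delta eqxx gtn_eqF // muln0; split=> // k jk _.
  by rewrite !gtn_eqF ?muln0 // (ltn_trans ij).
move=> v; have [x x0 ->] := valuation_surj v.
have [a [b [b0 xE]]] := ev_frac x.
have a0 : ev a <> 0 by move=> a0; move: x0; rewrite xE a0 mul0r eqxx.
have [u ea] := lr_lead (fun h => a0 ((same_ker a).1 h)).
have [w eb] := lr_lead (fun h => b0 ((same_ker b).1 h)).
exists (fun i => Posz (u i) - Posz (w i)).
under eq_bigr => i _ do rewrite mulrzBr -!pmulrn.
rewrite sumrB -(lex_place_exact ea) -(lex_place_exact eb).
apply: (addIr (valuation lex_place (ev b))).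
by rewrite subrK -valuationM // ?xE ?divfK //; apply/eqP.
Qed.

End PlaceOfEmbedding.

(** * Subalgebras and evaluation of polynomials *)

Lemma mpoly_ring_ind (R : comNzRingType) n (P : {mpoly R[n]} -> Prop) :
  (forall c, P c%:MP) -> (forall i, P 'X_i) ->
  (forall p q, P p -> P q -> P (p + q)) ->
  (forall p q, P p -> P q -> P (p * q)) -> forall p, P p.
Proof.
move=> hC hX hD hM; have P1 : P 1 by apply: hC.
elim/mpolyind => [|c m p _ _ IH]; first by rewrite -mpolyC0.
apply: (hD) => //; rewrite -mul_mpolyC; apply: (hM) => //.
rewrite mpolyXE_id; apply: (big_ind P) => // i _.
by elim: (m i) => [|k IHk] //; rewrite exprS; apply: hM.
Qed.

Section Subalgebra.
Variables (K F : fieldType) (iota : {rmorphism K -> F}).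

(** The K-subalgebra of [F] generated by [S]. An inductive predicate depends on
    [S] only as a set, which spares the permutation of variables. *)
Inductive subalg (S : F -> Prop) : F -> Prop :=
| subalg_const a : subalg S (iota a)
| subalg_gen x : S x -> subalg S x
| subalg_add x y : subalg S x -> subalg S y -> subalg S (x + y)
| subalg_mul x y : subalg S x -> subalg S y -> subalg S (x * y).

Lemma subalg0 S : subalg S 0. Proof. by rewrite -(rmorph0 iota); constructor. Qed.
Lemma subalg1 S : subalg S 1. Proof. by rewrite -(rmorph1 iota); constructor. Qed.
Lemma subalgN S x : subalg S x -> subalg S (- x).
Proof.
move=> Sx; rewrite -mulN1r -(rmorphN1 iota); apply: subalg_mul => //; constructor.
Qed.

Lemma subalg_sum S (I : Type) (r : seq I) (P : pred I) (f : I -> F) :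
  (forall i, P i -> subalg S (f i)) -> subalg S (\sum_(i <- r | P i) f i).
Proof.
by move=> h; apply: (big_ind (subalg S)) => //; [exact: subalg0 | exact: subalg_add].
Qed.

Lemma subalg_mono (S T : F -> Prop) x :
  (forall y, S y -> T y) -> subalg S x -> subalg T x.
Proof.
move=> ST; elim=> [a|y /ST|y z _ h1 _ h2|y z _ h1 _ h2]; first exact: subalg_const.
- exact: subalg_gen.
- exact: subalg_add.
exact: subalg_mul.
Qed.

Definition poly_over S (p : {poly F}) := forall i, subalg S p`_i.

Lemma poly_overC S a : subalg S a -> poly_over S a%:P.
Proof. by move=> h i; rewrite coefC; case: ifP => // _; apply: subalg0. Qed.

Lemma poly_overX S : poly_over S 'X.
Proof. by move=> i; rewrite coefX; case: eqP => _; [apply: subalg1|apply: subalg0]. Qed.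

Lemma poly_overD S p q : poly_over S p -> poly_over S q -> poly_over S (p + q).
Proof. by move=> hp hq i; rewrite coefD; apply: subalg_add. Qed.

Lemma poly_overM S p q : poly_over S p -> poly_over S q -> poly_over S (p * q).
Proof. by move=> hp hq i; rewrite coefM; apply: subalg_sum => j _; apply: subalg_mul. Qed.

(** Separability of [y] over [S], stated without minimal polynomials. *)
Definition simple_root_over S y :=
  exists p, [/\ poly_over S p, p.[y] = 0 & p^`().[y] <> 0].

Section Evaluation.
Variables (n : nat) (s : 'I_n -> F).

Definition peval : {rmorphism {mpoly K[n]} -> F} := meval s \o map_mpoly iota.

Lemma pevalC a : peval a%:MP = iota a.
Proof. by rewrite /= map_mpolyC mevalC. Qed.

Lemma pevalX i : peval 'X_i = s i.
Proof. by rewrite /= map_mpolyX mevalXU. Qed.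

Lemma pevalE p : peval p = \sum_(m <- msupp p) iota p@_m * \prod_i s i ^+ m i.
Proof.
by rewrite [in LHS](mpolyE p) rmorph_sum; apply: eq_bigr => m _;
  rewrite -mul_mpolyC rmorphM pevalC /= map_mpolyX mevalX.
Qed.

Variable i : 'I_n.

(** The values of all variables except the [i]-th are substituted. *)
Definition as_poly_in : {rmorphism {mpoly K[n]} -> {poly F}} :=
  mmap (polyC \o iota) (fun j => if j == i then 'X else (s j)%:P).

Lemma as_poly_inC a : as_poly_in a%:MP = (iota a)%:P.
Proof. exact: mmapC. Qed.

Lemma as_poly_inX j : as_poly_in 'X_j = if j == i then 'X else (s j)%:P.
Proof. by rewrite /= mmapX mmap1U. Qed.

Lemma as_poly_in_horner p : (as_poly_in p).[s i] = peval p.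
Proof.
elim/mpoly_ring_ind: p => [a|j|p q IHp IHq|p q IHp IHq].
- by rewrite as_poly_inC hornerC pevalC.
- by rewrite as_poly_inX pevalX; case: eqP => [->|_]; rewrite ?hornerX ?hornerC.
- by rewrite !rmorphD hornerD IHp IHq.
by rewrite !rmorphM hornerM IHp IHq.
Qed.

Lemma as_poly_in_deriv p : (as_poly_in p)^`() = as_poly_in p^`M(i).
Proof.
elim/mpoly_ring_ind: p => [a|j|p q IHp IHq|p q IHp IHq].
- by rewrite as_poly_inC derivC mderivC rmorph0.
- rewrite as_poly_inX mderivX mnm1E; case: eqP => [->|_].
    rewrite derivX scale1r -[X in (X - _)%MM]add0m addmK.
    by rewrite mpolyX0 rmorph1.
  by rewrite derivC scale0r rmorph0.
- by rewrite mderivD !rmorphD derivD IHp IHq.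
by rewrite mderivM rmorphD !rmorphM derivM IHp IHq.
Qed.

Lemma as_poly_in_over p :
  poly_over (fun x => exists2 j, j != i & x = s j) (as_poly_in p).
Proof.
elim/mpoly_ring_ind: p => [a|j|p q IHp IHq|p q IHp IHq].
- by rewrite as_poly_inC; apply/poly_overC/subalg_const.
- rewrite as_poly_inX; case: eqP => [_|/eqP ji]; first exact: poly_overX.
  by apply/poly_overC/subalg_gen; exists j.
- by rewrite rmorphD; apply: poly_overD.
by rewrite rmorphM; apply: poly_overM.
Qed.

End Evaluation.
End Subalgebra.

(** * Separable generation *)

Section ExistentiallyClosed.
Variables (K F : fieldType) (iota : {rmorphism K -> F}).
Hypothesis hK : existentially_closed iota.

Lemma ec_peval n (s : 'I_n -> F) (eqs : seq {mpoly K[n]}) (h : {mpoly K[n]}) :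
  (forall e, e \in eqs -> peval iota s e = 0) -> peval iota s h <> 0 ->
  exists y : 'I_n -> K, (forall e, e \in eqs -> e.@[y] = 0) /\ h.@[y] <> 0.
Proof.
move=> e0 h0; have [|y [ye yh]] := hK (f := tnth (in_tuple eqs)) (g := h).
  by exists s; split=> // i; apply: e0; apply: mem_tnth.
by exists y; split=> // e /(@tnthP _ _ (in_tuple eqs)) [i ->].
Qed.

(** Linear disjointness of [F] from the field of [p]-th roots of [K], by induction
    on the number of terms. If [u ord0] is not 0, existential closedness gives
    scalars [b] with [b ord0] not 0 that satisfy the same relation as [u].
    Subtracting the multiple of this relation by [(u ord0 / b ord0) ^+ p] cancels
    the first term and, by additivity of the Frobenius map, leaves a shorter
    relation between the elements [u j - b j / b ord0 * u ord0]. *)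
Lemma frobenius_dependence p k (c : 'I_k -> K) (u : 'I_k -> F) :
  p \in [pchar K] -> (exists j, c j != 0) ->
  \sum_j iota (c j) * u j ^+ p = 0 ->
  exists2 b : 'I_k -> K, exists j, b j != 0 & \sum_j iota (b j) * u j = 0.
Proof.
move=> pK; have pF : p \in [pchar F] by rewrite (fmorph_pchar iota).
have p_gt0 : (0 < p)%N by rewrite prime_gt0 // (pcharf_prime pK).
elim: k c u => [|k IH] c u; first by case=> -[].
move=> c0 rel; have [u0|u0] := eqVneq (u ord0) 0.
  exists (fun j => (j == ord0)%:R); first by exists ord0; rewrite eqxx oner_neq0.
  rewrite (bigD1 ord0) //= u0 mulr0 add0r big1 // => j /negbTE ->.
  by rewrite rmorph0 mul0r.
pose f : {mpoly K[k.+1]} := \sum_j (c j)%:MP * 'X_j ^+ p.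
have evf (y : 'I_k.+1 -> K) : f.@[y] = \sum_j c j * y j ^+ p.
  rewrite rmorph_sum; apply: eq_bigr => j _.
  by rewrite rmorphM rmorphXn /= mevalC mevalXU.
have [||b [bf b0]] := @ec_peval _ u [:: f] 'X_ord0.
- move=> e; rewrite inE => /eqP ->; rewrite rmorph_sum -[RHS]rel.
  by apply: eq_bigr => j _; rewrite rmorphM rmorphXn pevalC pevalX.
- by rewrite pevalX; apply/eqP.
move: b0; rewrite mevalXU => /eqP b0.
have {}bf := bf f (mem_head _ _); rewrite {}evf in bf.
pose c' j := c (lift ord0 j); pose r j := b (lift ord0 j) / b ord0.
pose u' j := u (lift ord0 j) - iota (r j) * u ord0.
move: rel bf; rewrite !big_ord_recl => rel bf.
have [||b' b'0 rel'] := IH c' u'.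
- case: (boolP [exists j, c' j != 0]) => [/existsP //|].
  rewrite negb_exists => /forallP c'0; exfalso; case: c0 => j.
  have {}c'0 i : c (lift ord0 i) = 0 by apply/eqP/negPn/c'0.
  case: (unliftP ord0 j) => [i ->|->]; first by rewrite c'0 eqxx.
  move: bf; rewrite big1 ?addr0; last by move=> i _; rewrite c'0 mul0r.
  by move/eqP; rewrite mulf_eq0 expf_eq0 (negbTE b0) andbF orbF => /eqP ->; rewrite eqxx.
- rewrite (eq_bigr (fun j => iota (c (lift ord0 j)) * u (lift ord0 j) ^+ p -
    iota (c (lift ord0 j) * b (lift ord0 j) ^+ p) * (u ord0 / iota (b ord0)) ^+ p)).
    have ib0 : iota (b ord0) != 0 by rewrite fmorph_eq0.
    move/eqP: rel; rewrite addr_eq0 -eqr_oppLR => /eqP rel.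
    move/eqP: bf; rewrite addr_eq0 -eqr_oppLR => /eqP bf.
    rewrite sumrB -mulr_suml -{}rel -rmorph_sum -{}bf rmorphN mulNr opprK.
    rewrite rmorphM rmorphXn -mulrA -exprMn mulrCA divff // mulr1.
    by rewrite addNr.
  move=> j _; rewrite /u' -(pFrobenius_autE pF) rmorphB /= !pFrobenius_autE.
  rewrite mulrBr /c' /r !rmorphM rmorphXn fmorphV -[in RHS]mulrA -exprMn.
  by rewrite [X in _ - _ * X ^+ p]mulrAC mulrA.
exists (fun j => if unlift ord0 j is Some i then b' i else - \sum_i b' i * r i).
  by have [j b'j] := b'0; exists (lift ord0 j); rewrite liftK.
rewrite big_ord_recl unlift_none rmorphN mulNr rmorph_sum mulr_suml.
under [X in _ + X]eq_bigr => i _ do rewrite liftK.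
rewrite addrC -sumrB -[RHS]rel'; apply: eq_bigr => i _.
by rewrite [iota (b' i * _)]rmorphM -mulrA -mulrBr.
Qed.

End ExistentiallyClosed.

Lemma msize_ltP (R : nzRingType) n (p : {mpoly R[n]}) k :
  (0 < k)%N -> (forall m, m \in msupp p -> (mdeg m).+1 < k)%N -> (msize p < k)%N.
Proof.
move=> k0 h; rewrite msizeE -(prednK k0) ltnS.
by apply/bigmax_leqP_seq => m mp _; rewrite -ltnS prednK // h.
Qed.

Lemma msize_mderiv (R : nzRingType) n (p : {mpoly R[n]}) i :
  p != 0 -> (msize p^`M(i) < msize p)%N.
Proof.
move=> p0; apply: msize_ltP => [|m]; first by rewrite lt0n msize_poly_eq0.
rewrite mcoeff_msupp mcoeff_mderiv => h.
have : (m + U_(i))%MM \in msupp p.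
  by rewrite mcoeff_msupp; apply: contraNneq h => ->; rewrite mul0rn.
by move/msize_mdeg_lt; rewrite mdegD mdeg1 addn1.
Qed.

Section MacLane.
Variables (K F : fieldType) (iota : {rmorphism K -> F}).
Hypothesis hK : existentially_closed iota.
Variables (n : nat) (s : 'I_n -> F).

Definition mnm_div (m : 'X_{1..n}) p : 'X_{1..n} := [multinom (m i %/ p)%N | i < n].

(** If all exponents of [P] are divisible by [p], the relation [P] is an equation
    between [p]-th powers of monomials, from which linear disjointness extracts a
    relation of smaller degree between these monomials themselves. *)
Lemma frobenius_descent p (P : {mpoly K[n]}) :
  p \in [pchar K] -> P != 0 -> peval iota s P = 0 ->
  (forall m, m \in msupp P -> forall i, (p %| m i)%N) ->
  exists Q, [/\ Q != 0, peval iota s Q = 0 & (msize Q < msize P)%N].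
Proof.
move=> pK P0 ePs dvd; pose M := msupp P; pose k := size M.
have p_pr := pcharf_prime pK.
pose m_ (j : 'I_k) := nth 0%MM M j; have mM j : m_ j \in M by apply: mem_nth.
have m_inj : injective m_.
  by move=> i j /eqP; rewrite nth_uniq ?msupp_uniq // => /eqP/val_inj.
have mE j i : m_ j i = (mnm_div (m_ j) p i * p)%N.
  by rewrite mnmE divnK // dvd.
have div_inj j j' : mnm_div (m_ j) p = mnm_div (m_ j') p -> j = j'.
  by move=> e; apply/m_inj/mnmP => i; rewrite !mE e.
have P_gt1 : (1 < msize P)%N.
  rewrite ltnNge; apply/negP => /msize1_polyC Pc; move: ePs P0.
  rewrite Pc pevalC => /eqP; rewrite fmorph_eq0 => /eqP ->.
  by rewrite mpolyC0 eqxx.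
have [||b [j0 bj0] rel] := @frobenius_dependence _ _ _ hK p k
    (fun j => P@_(m_ j)) (fun j => \prod_i s i ^+ mnm_div (m_ j) p i) pK.
- have k0 : (0 < k)%N by rewrite lt0n size_eq0 msupp_eq0.
  by exists (Ordinal k0); rewrite -mcoeff_msupp.
- rewrite -[RHS]ePs pevalE (big_nth 0%MM) big_mkord; apply: eq_bigr => j _.
  congr (_ * _); rewrite -prodrXl; apply: eq_bigr => i _.
  by rewrite -exprM -mE.
exists (\sum_j b j *: 'X_[mnm_div (m_ j) p]); split.
- apply: contraNneq bj0 => /(congr1 (mcoeff (mnm_div (m_ j0) p))).
  rewrite mcoeff0 raddf_sum (bigD1 j0) //= mcoeffZ mcoeffX eqxx mulr1 big1 ?addr0.
    by move=> ->.
  move=> j /eqP jj0; rewrite mcoeffZ mcoeffX; case: eqP => [/div_inj //|_].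
  by rewrite mulr0.
- rewrite -[RHS]rel rmorph_sum; apply: eq_bigr => j _.
  by rewrite -mul_mpolyC rmorphM pevalC /= map_mpolyX mevalX.
apply: msize_ltP => [|m]; first exact: ltnW.
move=> /msupp_sum_le; rewrite filter_predT => /flatten_mapP [j _].
move=> /msuppZ_le; rewrite msuppX inE => /eqP ->.
have := msize_mdeg_lt (mM j); have -> : mdeg (m_ j) = (mdeg (mnm_div (m_ j) p) * p)%N.
  by rewrite !mdegE big_distrl /=; apply: eq_bigr.
have := prime_gt1 p_pr; case: (mdeg _) => [//|d] p1; apply: leq_trans.
by rewrite ltnS; apply: leq_trans (leq_mul (leqnn _) p1); rewrite muln2 -addnn; lia.
Qed.

(** MacLane's criterion. In a relation of least degree some partial derivative is
    not the zero polynomial, for otherwise the characteristic is positive and the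
    relation descends; being of smaller degree, that derivative does not vanish at
    [s], so that the corresponding entry of [s] is a simple root over the others. *)
Lemma relation_simple_root (P : {mpoly K[n]}) :
  P != 0 -> peval iota s P = 0 ->
  exists i, simple_root_over iota (fun x => exists2 j, j != i & x = s j) (s i).
Proof.
have [k] := ubnP (msize P); elim: k P => // k IH P; rewrite ltnS => Pk P0 eP.
have [[i Pi]|] := pselect (exists i, peval iota s P^`M(i) <> 0).
  exists i; exists (as_poly_in iota s i P); split.
  - exact: as_poly_in_over.
  - by rewrite as_poly_in_horner.
  by rewrite as_poly_in_deriv as_poly_in_horner.
move=> /forallNP evd; have {}evd i : peval iota s P^`M(i) = 0.
  exact: contrapT (evd i).
have [[i Pi]|/forallNP d0] := pselect (exists i, P^`M(i) != 0).
  by apply: IH (evd i) => //; apply: leq_trans Pk; apply: msize_mderiv.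
have coef0 m i : m \in msupp P -> (m i)%:R = 0 :> K.
  move=> mP; have [->//|mi] := posnP (m i).
  have /mpolyP/(_ (m - U_(i))%MM) : P^`M(i) = 0 by apply/eqP/negPn/negP/d0.
  rewrite mcoeff0 mcoeff_mderiv submK.
    rewrite mnmBE mnm1E eqxx subn1 prednK // -[P@_m *+ _]mulr_natr => /eqP.
    by rewrite mulf_eq0 mcoeff_eq0 mP => /eqP.
  by apply/mnm_lepP => j; rewrite mnm1E; case: eqP => [<-|].
have [m mP m0] : exists2 m, m \in msupp P & m != 0%MM.
  apply: contrapT => h; move: eP P0; have -> : P = (P@_0)%:MP.
    apply/mpolyP => m; rewrite mcoeffC; case: eqP => [<-|/eqP m0].
      by rewrite mulr1.
    rewrite mulr0; apply/eqP; rewrite mcoeff_eq0; apply/negP => mP.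
    by apply: h; exists m; rewrite // eq_sym.
  by rewrite pevalC => /eqP; rewrite fmorph_eq0 => /eqP ->; rewrite mpolyC0 eqxx.
have [i mi] : exists i, m i != 0%N.
  apply: contrapT => /forallNP h; move/eqP: m0; apply; apply/mnmP => i.
  by rewrite mnm0E; apply/eqP/negPn/negP/h.
have [p pK] : exists p, p \in [pchar K].
  by apply: (@natf0_pchar _ (m i)); rewrite ?lt0n // coef0.
have [|Q [Q0 eQ QP]] := @frobenius_descent p P pK P0 eP.
  by move=> m' m'P j; rewrite (dvdn_pcharf pK) coef0.
by apply: IH eQ => //; apply: leq_trans Pk.
Qed.

End MacLane.

Section Tower.
Variables (K F : fieldType) (iota : {rmorphism K -> F}).

(** The second argument lists all generators, the latest first, and ends with [t]. *)
Inductive separable_tower (t : seq F) : seq F -> Prop :=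
| tower_base : separable_tower t t
| tower_step s y : separable_tower t s ->
    simple_root_over iota (fun x => x \in s) y -> separable_tower t (y :: s).

(** As long as the elements are dependent, MacLane's criterion removes one of them,
    which is separable over the others. *)
Lemma exists_separable_tower (s : seq F) : existentially_closed iota ->
  exists d (t : d.-tuple F) s',
    [/\ algebraically_independent iota t, separable_tower t s' & s' =i s].
Proof.
move=> hK; have [k] := ubnP (size s); elim: k s => // k IH s; rewrite ltnS => sk.
have [ind|] := pselect (algebraically_independent iota (in_tuple s)).
  by exists (size s), (in_tuple s), s; split=> //; constructor.
move=> /existsNP [P] /not_implyP [eP /eqP P0].
have [i [p [p_s py py']]] :=
  relation_simple_root hK (s := tnth (in_tuple s)) P0 eP.
pose y := tnth (in_tuple s) i; pose s1 := take i s ++ drop i.+1 s.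
have sE : s = take i s ++ y :: drop i.+1 s.
  by rewrite /y (tnth_nth 0) /= -drop_nth ?cat_take_drop // ltn_ord.
have [|d [t [s' [ind tow s's1]]]] := IH s1.
  apply: leq_trans sk; rewrite [in X in (_ < X)%N]sE !size_cat /=.
  by rewrite addnS ltnS.
exists d, t, (y :: s'); split=> //.
  constructor=> //; exists p; split=> // j; apply: subalg_mono (p_s j).
  move=> _ [l li ->]; rewrite s's1 mem_cat (tnth_nth 0) /=.
  have := ltn_ord l; case: (ltngtP l i) => [l_i lt|il lt|/val_inj e].
  - by rewrite -(nth_take _ l_i) mem_nth // size_take ltn_ord.
  - apply/orP; right; rewrite -[val l](subnKC il) -nth_drop mem_nth //.
    by rewrite size_drop ltn_sub2r // (leq_ltn_trans il).
  by rewrite e eqxx in li.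
move=> z; rewrite [in RHS]sE inE s's1 !mem_cat inE.
by case: (z == y); rewrite ?orbT.
Qed.

End Tower.

Section Independence.
Variables (K F : fieldType) (iota : {rmorphism K -> F}).
Variables (d : nat) (t : d.-tuple F) (x : F).

Let xt := tnth (cons_tuple x t).

(** This identifies polynomials in one variable over the algebra generated by [t]
    with polynomials in [d.+1] variables. *)
Lemma as_poly_in_surj p : poly_over iota (fun y => y \in (t : seq F)) p ->
  exists Q, as_poly_in iota xt ord0 Q = p.
Proof.
have constP a : subalg iota (fun y => y \in (t : seq F)) a ->
    exists Q, as_poly_in iota xt ord0 Q = a%:P.
  elim=> [c|y /tnthP[j ->]|y z _ [Q1 e1] _ [Q2 e2]|y z _ [Q1 e1] _ [Q2 e2]].
  - by exists c%:MP; rewrite as_poly_inC.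
  - by exists 'X_(lift ord0 j); rewrite as_poly_inX /= /xt tnthS.
  - by exists (Q1 + Q2); rewrite rmorphD e1 e2 polyCD.
  by exists (Q1 * Q2); rewrite rmorphM e1 e2 polyCM.
move=> hp; rewrite -[p]coefK poly_def.
apply: (big_ind (fun q => exists Q, as_poly_in iota xt ord0 Q = q)).
- by exists 0; rewrite rmorph0.
- by move=> _ _ [Q1 <-] [Q2 <-]; exists (Q1 + Q2); rewrite rmorphD.
move=> i _; have [Q e] := constP _ (hp i); exists (Q * 'X_ord0 ^+ i).
by rewrite rmorphM rmorphXn as_poly_inX eqxx e mul_polyC.
Qed.

Hypothesis ind : algebraically_independent iota (cons_tuple x t).

Lemma independent_transcendental p :
  poly_over iota (fun y => y \in (t : seq F)) p -> p.[x] = 0 -> p = 0.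
Proof.
move=> /as_poly_in_surj [Q <-]; have -> : x = xt ord0 by rewrite /xt tnth0.
by rewrite as_poly_in_horner => /ind ->; rewrite rmorph0.
Qed.

Lemma independent_behead : algebraically_independent iota t.
Proof.
move=> q eq0; pose Q : {mpoly K[d.+1]} := mmap (@mpolyC _ K) (fun j => 'X_(lift ord0 j)) q.
pose back : {mpoly K[d.+1]} -> {mpoly K[d]} := mmap (@mpolyC _ K)
  (fun j => if unlift ord0 j is Some j' then 'X_j' else 0).
have backQ : back Q = q.
  rewrite /Q; elim/mpoly_ring_ind: q {eq0 Q} => [c|j|p q IHp IHq|p q IHp IHq].
  - by rewrite /back !mmapC.
  - by rewrite /back mmapX mmap1U mmapX mmap1U liftK.
  - by rewrite /back !rmorphD /= -[in RHS]IHp -[in RHS]IHq.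
  by rewrite /back !rmorphM /= -[in RHS]IHp -[in RHS]IHq.
have eQ : peval iota xt Q = peval iota (tnth t) q.
  rewrite /Q; elim/mpoly_ring_ind: q {eq0 Q backQ} => [c|j|p q IHp IHq|p q IHp IHq].
  - by rewrite mmapC !pevalC.
  - by rewrite mmapX mmap1U !pevalX /xt tnthS.
  - by rewrite 3!rmorphD IHp IHq.
  by rewrite 3!rmorphM IHp IHq.
have Q0 : Q = 0 by apply: ind; rewrite -[LHS]/(peval iota xt Q) eQ.
by rewrite -backQ Q0 /back rmorph0.
Qed.

End Independence.

(** * The transcendence degree *)

Section FractionSubfield.
Variables (K F : fieldType) (iota : {rmorphism K -> F}) (S : F -> Prop).

Definition subalg_frac (x : F) : Prop :=
  exists a b, [/\ subalg iota S a, subalg iota S b, b != 0 & x = a / b].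

Definition in_subalg_frac : {pred F} := fun x => `[< subalg_frac x >].

Lemma subalg_frac_subalg x : subalg iota S x -> subalg_frac x.
Proof.
by exists x, 1; split; rewrite ?divr1 ?oner_neq0 //; apply: subalg1.
Qed.

Fact subalg_frac_divring_closed : divring_closed in_subalg_frac.
Proof.
split=> [|x y|x y].
- exact/asboolP/subalg_frac_subalg/subalg1.
- move=> /asboolP [a [b [aS bS b0 ->]]] /asboolP [c [e [cS eS e0 ->]]].
  apply/asboolP; exists (a * e + - c * b), (b * e); split.
  + by apply: subalg_add; apply: subalg_mul => //; apply: subalgN.
  + exact: subalg_mul.
  + by rewrite mulf_neq0.
  by rewrite -mulNr addf_div.
move=> /asboolP [a [b [aS bS b0 ->]]] /asboolP [c [e [cS eS e0 ->]]].
apply/asboolP; have [->|c0] := eqVneq c 0.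
  by rewrite mul0r invr0 mulr0; apply/subalg_frac_subalg/subalg0.
exists (a * e), (b * c); split; try exact: subalg_mul.
  by rewrite mulf_neq0.
by rewrite invf_div mulf_div.
Qed.

HB.instance Definition _ :=
  GRing.isDivringClosed.Build F in_subalg_frac subalg_frac_divring_closed.

(** The fraction field of the algebra generated by [S], as a type, so that the
    closure properties of algebraic elements apply. *)
Record frac_subfield := FracSubfield {
  frac_val :> F;
  _ : frac_val \in in_subalg_frac }.

HB.instance Definition _ := [isSub for frac_val].
HB.instance Definition _ := [Choice of frac_subfield by <:].
HB.instance Definition _ := [SubChoice_isSubUnitRing of frac_subfield by <:].
HB.instance Definition _ := [SubNzRing_isSubComNzRing of frac_subfield by <:].
HB.instance Definition _ :=
  [SubComUnitRing_isSubIntegralDomain of frac_subfield by <:].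
HB.instance Definition _ := [SubIntegralDomain_isSubField of frac_subfield by <:].

Definition frac_emb : {rmorphism frac_subfield -> F} := val.
Definition algebraic_over_frac (x : F) := algebraicOver frac_emb x.

Lemma algebraic_frac x : subalg_frac x -> algebraic_over_frac x.
Proof.
move=> /asboolP xL; have -> : x = frac_emb (FracSubfield xL) by [].
exact: algebraic_id.
Qed.

Lemma algebraic_subalg (S' : F -> Prop) x :
  (forall y, S' y -> algebraic_over_frac y) -> subalg iota S' x ->
  algebraic_over_frac x.
Proof.
move=> h; elim=> [a|y /h //|y z _ hy _ hz|y z _ hy _ hz].
- exact/algebraic_frac/subalg_frac_subalg/subalg_const.
- exact: algebraic_add.
exact: algebraic_mul.
Qed.

Lemma algebraic_simple_root (S' : F -> Prop) x :
  (forall y, S' y -> algebraic_over_frac y) -> simple_root_over iota S' x ->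
  algebraic_over_frac x.
Proof.
move=> h [p [pS px p'x]]; apply/integral_algebraic.
apply: (@integral_root _ _ frac_emb p).
- by apply: contra_not_neq p'x => ->; rewrite deriv0 horner0.
- exact/rootP.
by move=> _ /(nthP 0)[i _ <-]; apply/integral_algebraic/(algebraic_subalg h).
Qed.

Definition in_algebraic_closure : {pred F} := fun x => `[< algebraic_over_frac x >].

Lemma algebraic_closure_divring_closed : divring_closed in_algebraic_closure.
Proof.
split=> [|x y /asboolP hx /asboolP hy|x y /asboolP hx /asboolP hy]; apply/asboolP.
- exact: algebraic1.
- exact: algebraic_sub.
exact: algebraic_div.
Qed.

Lemma clear_denominators (p : {poly F}) : (forall i, subalg_frac p`_i) ->
  exists b, [/\ subalg iota S b, b != 0 & poly_over iota S (b *: p)].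
Proof.
elim/poly_ind: p => [|p c IH] h.
  exists 1; split; [exact: subalg1|exact: oner_neq0|].
  by move=> i; rewrite scaler0 coef0; apply: subalg0.
have [i|b [bS b0 bp]] := IH.
  by have := h i.+1; rewrite coefD coefMX coefC addr0.
have [a [e [aS eS e0 cE]]] : subalg_frac c.
  by have := h 0%N; rewrite coefD coefMX coefC add0r.
exists (e * b); split; [exact: subalg_mul|exact: mulf_neq0|] => -[|i].
  rewrite coefZ coefD coefMX coefC add0r cE /= mulrC mulrA divfK //.
  exact: subalg_mul.
rewrite coefZ coefD coefMX coefC addr0 /= -mulrA; apply: subalg_mul => //.
by rewrite -coefZ.
Qed.

Lemma algebraic_relation x : algebraic_over_frac x ->
  exists p, [/\ p != 0, poly_over iota S p & p.[x] = 0].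
Proof.
move=> [q q0 qx]; have [i|b [bS b0 bq]] := @clear_denominators (map_poly frac_emb q).
  by rewrite coef_map; apply/asboolP; apply: (valP q`_i).
exists (b *: map_poly frac_emb q); split=> //.
  by rewrite scaler_eq0 negb_or b0 map_poly_eq0.
by rewrite hornerZ (rootP qx) mulr0.
Qed.

End FractionSubfield.

Section TranscendenceBasis.
Variables (K F : fieldType) (iota : {rmorphism K -> F}).

Lemma tower_algebraic t s x : separable_tower iota t s -> x \in s ->
  algebraic_over_frac iota (fun y => y \in t) x.
Proof.
move=> tow; elim: tow x => [x xt|s' y _ IH root x].
  exact/algebraic_frac/subalg_frac_subalg/subalg_gen.
rewrite inE => /orP[/eqP ->|]; last exact: IH.
exact: algebraic_simple_root root.
Qed.

Section GeneratedByTower.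
Variables (t s s0 : seq F).
Hypothesis gen : forall E : {pred F}, divring_closed E ->
  (forall a, iota a \in E) -> {subset s0 <= E} -> forall x, x \in E.
Hypothesis s0s : {subset s0 <= s}.
Hypothesis tow : separable_tower iota t s.

Lemma tower_all_algebraic x : algebraic_over_frac iota (fun y => y \in t) x.
Proof.
suff /asboolP : x \in in_algebraic_closure iota (fun y => y \in t) by [].
apply: gen => [|a|y /s0s ys]; first exact: algebraic_closure_divring_closed.
  exact/asboolP/algebraic_frac/subalg_frac_subalg/subalg_const.
exact/asboolP/(tower_algebraic tow).
Qed.

End GeneratedByTower.

(** [F] is generated by elements that are algebraic over [t]. *)
Lemma tower_transcendence_basis d (t : d.-tuple F) s (s0 : seq F) :
  (forall E : {pred F}, divring_closed E -> (forall a, iota a \in E) ->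
    {subset s0 <= E} -> forall x, x \in E) ->
  {subset s0 <= s} ->
  algebraically_independent iota t -> separable_tower iota t s ->
  transcendence_basis iota t.
Proof.
move=> gen s0s ind tow; split=> // x indx.
have [p [p0 pS px]] := algebraic_relation (tower_all_algebraic gen s0s tow x).
by move: p0; rewrite (independent_transcendental indx pS px) eqxx.
Qed.

End TranscendenceBasis.

(** * Minimal equations *)

(** Integrality as a bare property, for rings of power series that are only known
    as commutative rings. *)
Definition domain_like (S : nzRingType) :=
  forall a b : S, a * b = 0 -> a = 0 \/ b = 0.

Lemma field_domain (F : fieldType) : domain_like F.
Proof. by move=> a b /eqP; rewrite mulf_eq0 => /orP[] /eqP; [left|right]. Qed.

Lemma domain_likeX (S : nzRingType) (a : S) k :
  domain_like S -> a <> 0 -> a ^+ k <> 0.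
Proof.
move=> dom a0; elim: k => [|k IH]; first exact/eqP/oner_neq0.
by rewrite exprS => /dom [].
Qed.

Lemma size_map_poly_leq (B S : nzRingType) (f : {rmorphism B -> S}) p :
  (size (map_poly f p) <= size p)%N.
Proof. by rewrite map_polyE (leq_trans (size_Poly _)) // size_map. Qed.

Section MinimalVanishing.
Variables (B S : comNzRingType) (f : {rmorphism B -> S}) (y : S).
Implicit Types p m : {poly B}.

(** The image of [m] plays the role of the minimal polynomial of [y] over the
    fraction field of the image of [f]. The condition on sizes makes the leading
    coefficient of [m] survive in the image. *)
Definition minimal_vanishing m :=
  [/\ map_poly f m <> 0, size m = size (map_poly f m), (map_poly f m).[y] = 0
    & forall p, (map_poly f p).[y] = 0 ->
        (size (map_poly f p) < size m)%N -> map_poly f p = 0].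

Lemma minimal_vanishing_lead m : minimal_vanishing m -> f (lead_coef m) <> 0.
Proof.
case=> m0 sm _ _; rewrite lead_coefE sm -coef_map -lead_coefE.
by apply/eqP; rewrite lead_coef_eq0; apply/eqP.
Qed.

Lemma minimal_vanishing_neq0 m : minimal_vanishing m -> m != 0.
Proof. by case=> m0 _ _ _; apply: contra_not_neq m0 => ->; rewrite rmorph0. Qed.

(** A polynomial whose image has least size is truncated to that size. *)
Lemma exists_minimal_vanishing p :
  map_poly f p <> 0 -> (map_poly f p).[y] = 0 -> exists m, minimal_vanishing m.
Proof.
move=> p0 py; pose Q k := `[< exists p, [/\ map_poly f p <> 0,
  (map_poly f p).[y] = 0 & size (map_poly f p) = k] >].
have ex : exists k, Q k by exists (size (map_poly f p)); apply/asboolP; exists p.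
have [k /asboolP[q [q0 qy qk]] kmin] := ex_minnP ex.
have e : map_poly f (take_poly k q) = map_poly f q.
  apply/polyP => i; rewrite !coef_map coef_take_poly; case: ltnP => // ki.
  by transitivity (0 : S); [exact: rmorph0 | rewrite -coef_map nth_default // qk].
exists (take_poly k q); split; rewrite ?e //.
  apply/eqP; rewrite eqn_leq qk size_take_poly /= -[X in (X <= _)%N]qk -e.
  exact: size_map_poly_leq.
move=> r ry; rewrite ltnNge => h; apply: contrapT => r0; move: h.
rewrite (leq_trans (size_take_poly _ _)) //.
by apply: kmin; apply/asboolP; exists r.
Qed.

Lemma pseudo_remainder m p : m != 0 -> exists k q r,
  (lead_coef m ^+ k) *: p = q * m + r /\ (size r < size m)%N.
Proof.
move=> m0; exists (Pdiv.CommonRing.rscalp p m), (Pdiv.CommonRing.rdivp p m).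
exists (Pdiv.CommonRing.rmodp p m).
by rewrite Pdiv.ComRing.rdivp_eq Pdiv.CommonRing.ltn_rmodp.
Qed.

Lemma map_pseudo_remainder m p k q r :
  (lead_coef m ^+ k) *: p = q * m + r ->
  f (lead_coef m) ^+ k *: map_poly f p =
  map_poly f q * map_poly f m + map_poly f r.
Proof. by move/(congr1 (map_poly f)); rewrite map_polyZ rmorphXn rmorphD rmorphM. Qed.

(** Vanishing at [y] is thus decided by the coefficients of a pseudo-remainder
    alone, that is, by the kernel of [f]. *)
Lemma minimal_vanishing_remainder m p k q r : domain_like S ->
  minimal_vanishing m ->
  (lead_coef m ^+ k) *: p = q * m + r -> (size r < size m)%N ->
  (map_poly f p).[y] = 0 <-> map_poly f r = 0.
Proof.
move=> dom mm /map_pseudo_remainder e rm; have [_ _ my mmin] := mm.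
have := congr1 (fun q => q.[y]) e; rewrite /= hornerD hornerM my mulr0 add0r hornerZ.
move=> ey; split=> [py|r0].
  apply: mmin; first by rewrite -ey py mulr0.
  by apply: leq_ltn_trans rm; rewrite map_polyE (leq_trans (size_Poly _)) // size_map.
move: ey; rewrite r0 horner0 => /dom [|//] lk; exfalso.
exact: domain_likeX (minimal_vanishing_lead mm) lk.
Qed.

End MinimalVanishing.

Lemma map_poly_eq0_iff (B S : nzRingType) (f : {rmorphism B -> S}) p :
  map_poly f p = 0 <-> forall i, f p`_i = 0.
Proof.
split=> [e i|h]; first by rewrite -coef_map e coef0.
by apply/polyP => i; rewrite coef_map coef0; apply: h.
Qed.

Section TransferMinimality.
Variables (B : comNzRingType) (F : fieldType) (S : comNzRingType).
Variables (ev : {rmorphism B -> F}) (rho : {rmorphism B -> S}) (x : F) (y : S).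
Hypothesis dom : domain_like S.
Hypothesis same_ker : forall b, rho b = 0 <-> ev b = 0.

Let ker_poly p : map_poly rho p = 0 <-> map_poly ev p = 0.
Proof. by rewrite !map_poly_eq0_iff; split=> h i; apply/same_ker. Qed.

(** Let [p] be minimal for [y], and suppose that it is smaller than [m]. Then [p]
    pseudo-divides [m] over [S], hence over [F] since the kernels agree. So [x] is a
    root of [p] or of the quotient, both of which are too small for this, unless
    [p] is a constant, and a nonzero constant does not vanish at [y]. *)
Lemma minimal_vanishing_transfer m :
  minimal_vanishing ev x m -> (map_poly rho m).[y] = 0 ->
  minimal_vanishing rho y m.
Proof.
move=> mm my; have [m0 sm mx mmin] := mm.
have rm0 : map_poly rho m <> 0 by move=> /ker_poly.
have srm : size m = size (map_poly rho m).
  apply/eqP; rewrite eqn_leq [X in _ && X]size_map_poly_leq.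
  rewrite andbT leqNgt; apply/negP => lt; have := minimal_vanishing_lead mm.
  rewrite lead_coefE; apply; apply/same_ker; rewrite -coef_map nth_default //.
  by rewrite -ltnS prednK // size_poly_gt0 (minimal_vanishing_neq0 mm).
have [p pp] := exists_minimal_vanishing rm0 my.
have [p0 sp py pmin] := pp.
suff mp : (size m <= size p)%N.
  split=> // q qy qm; apply: pmin => //; exact: leq_trans qm mp.
rewrite leqNgt; apply/negP => pm.
have [k [q [r [e rp]]]] := pseudo_remainder m (minimal_vanishing_neq0 pp).
have /(minimal_vanishing_remainder dom pp e rp)/ker_poly r0 := my.
have ep0 : map_poly ev p <> 0 by move=> /ker_poly.
have pl := minimal_vanishing_lead pp.
have epl : ev (lead_coef p) ^+ k != 0.
  by rewrite expf_neq0 //; apply/eqP => /same_ker.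
have szep : size (map_poly ev p) = size p.
  apply/eqP; rewrite eqn_leq size_map_poly_leq /=.
  rewrite leqNgt; apply/negP => lt; apply: pl.
  apply/same_ker; rewrite lead_coefE -coef_map nth_default //.
  by rewrite -ltnS prednK // size_poly_gt0 (minimal_vanishing_neq0 pp).
have := map_pseudo_remainder ev e; rewrite r0 addr0 => eF.
have eq0 : map_poly ev q <> 0.
  move=> z; move: eF; rewrite z mul0r => /eqP; rewrite scaler_eq0 (negbTE epl) /=.
  by move/eqP.
have := congr1 (fun u : {poly F} => size u) eF.
rewrite /= size_scale // -sm size_mul; try exact/eqP.
move=> szm; have p_gt1 : (1 < size p)%N.
  rewrite ltnNge; apply/negP => /size1_polyC pC; apply: p0.
  by move: py; rewrite pC map_polyC hornerC => ->; rewrite polyC0.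
have := congr1 (fun u : {poly F} => u.[x]) eF.
rewrite /= hornerZ mx mulr0 hornerM => /esym/eqP; rewrite mulf_eq0 => /orP[] /eqP h.
  apply/eq0/mmin => //; rewrite szm szep -subn1 -addnBA; last exact: ltnW.
  by rewrite -[X in (X < _)%N]addn0 ltn_add2l subn_gt0.
by apply/ep0/mmin => //; rewrite szep.
Qed.

(** If [x] and [y] are roots of one minimal polynomial, adjoining [x] to [F] and
    [y] to [S] keeps the two kernels equal. *)
Lemma vanishing_same m p :
  minimal_vanishing ev x m -> (map_poly rho m).[y] = 0 ->
  (map_poly rho p).[y] = 0 <-> (map_poly ev p).[x] = 0.
Proof.
move=> mm my; have mm' := minimal_vanishing_transfer mm my.
have [k [q [r [e rm]]]] := pseudo_remainder p (minimal_vanishing_neq0 mm).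
rewrite (minimal_vanishing_remainder dom mm' e rm).
by rewrite (minimal_vanishing_remainder (@field_domain F) mm e rm).
Qed.

End TransferMinimality.

(** * Lifting rational points to power series *)

Section PolyExt.
Variables (B S : comNzRingType).

Definition poly_ext (f : {rmorphism B -> S}) (u : S) : {rmorphism {poly B} -> S} :=
  horner_morph (fun a => mulrC u (f a)).

Lemma poly_extE (f : {rmorphism B -> S}) u p : poly_ext f u p = (map_poly f p).[u].
Proof. by []. Qed.

Lemma poly_extC (f : {rmorphism B -> S}) u b : poly_ext f u b%:P = f b.
Proof. exact: horner_morphC. Qed.

Lemma poly_extX (f : {rmorphism B -> S}) u : poly_ext f u 'X = u.
Proof. exact: horner_morphX. Qed.

Lemma poly_hom_eq (f g : {rmorphism {poly B} -> S}) :
  (forall b, f b%:P = g b%:P) -> f 'X = g 'X -> f =1 g.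
Proof.
move=> eC eX p; elim/poly_ind: p => [|p c IH]; first by rewrite !rmorph0.
by rewrite !rmorphD !rmorphM IH eX eC.
Qed.

End PolyExt.

Section Presentation.
Variables (K F : fieldType) (iota : {rmorphism K -> F}).
Variables (N : nat) (s : 'I_N -> F).

(** A K-algebra [B] with a homomorphism to a polynomial ring over [K]. Evaluation at
    [s] factors through it, and existential closedness of [K] then produces
    K-rational points of [B]. Adjoining a variable to [B] keeps the target fixed. *)
Record presentation := Presentation {
  pr_ring :> comNzRingType;
  pr_const : {rmorphism K -> pr_ring};
  pr_poly : {rmorphism pr_ring -> {mpoly K[N]}};
  pr_polyC : forall a, pr_poly (pr_const a) = a%:MP }.

Definition pr_ev (B : presentation) : {rmorphism B -> F} :=
  peval iota s \o @pr_poly B.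

Lemma pr_ev_const (B : presentation) a : pr_ev B (pr_const B a) = iota a.
Proof. by rewrite /= pr_polyC map_mpolyC mevalC. Qed.

Definition rational_point (B : presentation) (eqs : seq B) (h : B)
    (chi : {rmorphism B -> K}) :=
  [/\ forall a, chi (pr_const B a) = a, forall e, e \in eqs -> chi e = 0
    & chi h <> 0].

Lemma exists_rational_point (B : presentation) (eqs : seq B) (h : B) :
  existentially_closed iota ->
  (forall e, e \in eqs -> pr_ev B e = 0) -> pr_ev B h <> 0 ->
  exists chi, rational_point eqs h chi.
Proof.
move=> hK e0 h0.
have [|y [ye yh]] := ec_peval hK (eqs := map (@pr_poly B) eqs) _ h0.
  by move=> _ /mapP [e /e0 ee ->].
exists (meval y \o @pr_poly B); split=> [a|e e_in|] //=.
  by rewrite pr_polyC mevalC.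
by apply/ye/map_f.
Qed.

Definition generated_by (B : presentation) (S : seq F) :=
  (forall b, subalg iota (fun x => x \in S) (pr_ev B b)) /\
  (forall x, x \in S -> exists b, pr_ev B b = x).

Lemma generated_subalg (B : presentation) S x : generated_by B S ->
  subalg iota (fun x => x \in S) x -> exists b, pr_ev B b = x.
Proof.
move=> [_ gS]; elim=> [a|y|y z _ [b <-] _ [c <-]|y z _ [b <-] _ [c <-]].
- by exists (pr_const B a); rewrite pr_ev_const.
- exact: gS.
- by exists (b + c); rewrite rmorphD.
by exists (b * c); rewrite rmorphM.
Qed.

Lemma generated_poly (B : presentation) S p : generated_by B S ->
  poly_over iota (fun x => x \in S) p -> exists q, map_poly (pr_ev B) q = p.
Proof.
move=> gS hp; rewrite -[p]coefK poly_def.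
apply: (big_ind (fun q => exists Q, map_poly (pr_ev B) Q = q)).
- by exists 0; rewrite rmorph0.
- by move=> _ _ [Q1 <-] [Q2 <-]; exists (Q1 + Q2); rewrite rmorphD.
move=> i _; have [b e] := generated_subalg gS (hp i); exists (b *: 'X ^+ i).
by rewrite map_polyZ rmorphXn /= map_polyX; congr (_ *: _); exact: e.
Qed.

Lemma pr_adjoin_subproof (B : presentation) (i : 'I_N) a :
  poly_ext (@pr_poly B) 'X_i ((polyC \o pr_const B) a) = a%:MP.
Proof. by rewrite /= [LHS]poly_extC pr_polyC. Qed.

Definition pr_adjoin (B : presentation) (i : 'I_N) : presentation :=
  Presentation (@pr_adjoin_subproof B i).

Lemma pr_ev_adjoinE (B : presentation) i (p : {poly B}) :
  pr_ev (pr_adjoin B i) p = (map_poly (pr_ev B) p).[s i].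
Proof.
rewrite -poly_extE; apply: (@poly_hom_eq _ _ (pr_ev (pr_adjoin B i))) => [b|].
  by rewrite poly_extC /pr_ev /= -[horner_morph _ _]/(poly_ext _ _ _) poly_extC.
rewrite poly_extX /pr_ev /= -[horner_morph _ _]/(poly_ext _ _ _) poly_extX.
by rewrite map_mpolyX mevalXU.
Qed.

Lemma generated_adjoin (B : presentation) S i : generated_by B S ->
  generated_by (pr_adjoin B i) (s i :: S).
Proof.
move=> [gS Sg]; split=> [p|x].
  rewrite pr_ev_adjoinE horner_coef; apply: subalg_sum => j _; rewrite coef_map.
  apply: subalg_mul.
    by apply: subalg_mono (gS p`_j) => y yS; rewrite inE yS orbT.
  elim: (j : nat) => [|k IH]; first exact: subalg1.
  by rewrite exprS; apply: subalg_mul => //; apply: subalg_gen; rewrite mem_head.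
rewrite inE => /orP[/eqP ->|/Sg [b <-]].
  by exists 'X; rewrite pr_ev_adjoinE map_polyX hornerX.
by exists b%:P; rewrite pr_ev_adjoinE map_polyC hornerC.
Qed.

(** A lifting of the point [chi] to a point with values in power series, which
    embeds the algebra [pr_ev B] of [F] because the kernels agree. The elements
    [T i] are sent to the variables of the power series ring, shifted by their
    values at [chi]. *)
Record lifting (d : nat) (B : presentation) (T : nat -> B)
    (chi : {rmorphism B -> K}) := Lifting {
  lift_hom : {rmorphism B -> power_series K d};
  lift_const : forall a, lift_hom (pr_const B a) = lr_emb _ a;
  lift_res : forall b, lr_res _ (lift_hom b) = chi b;
  lift_ker : forall b, lift_hom b = 0 <-> pr_ev B b = 0;
  lift_var : forall i, (i < d)%N ->
    lift_hom (T i) = lr_emb _ (chi (T i)) + lr_var _ i }.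

(** Finitely many polynomial conditions, valid at the generic point, suffice for a
    K-rational point of the algebra generated by [S] to lift to power series in
    [d] variables. *)
Definition smooth (d : nat) (S : seq F) := exists (B : presentation) (T : nat -> B)
  (eqs : seq B) (h : B), [/\ generated_by B S,
    forall e, e \in eqs -> pr_ev B e = 0, pr_ev B h <> 0
  & forall chi, rational_point eqs h chi -> inhabited (lifting d T chi)].

Lemma smooth_nil : smooth 0 [::].
Proof.
pose B := @Presentation K idfun (@mpolyC N K) (fun a => erefl).
have evE b : pr_ev B b = iota b by rewrite -[RHS](pr_ev_const B).
exists B, (fun=> 0), [::], 1; split=> //.
- by split=> // b; rewrite evE; apply: subalg_const.
- by rewrite rmorph1; apply/eqP/oner_neq0.
move=> chi [chiK _ _]; split; apply: (@Lifting 0 B _ _ idfun) => //.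
  by move=> b; rewrite [RHS]chiK.
move=> b; rewrite evE; split=> [/= ->|/eqP]; first by rewrite rmorph0.
by rewrite fmorph_eq0 => /eqP.
Qed.

Lemma point_restrict (B : presentation) i eqs h (eqs' : seq {poly B}) h'
    (chi : {rmorphism pr_adjoin B i -> K}) :
  rational_point (B := pr_adjoin B i) (map polyC eqs ++ eqs') (h%:P * h') chi ->
  [/\ rational_point eqs h (chi \o polyC : {rmorphism B -> K}),
      forall e, e \in eqs' -> chi e = 0, chi h' <> 0
    & forall p, chi p = (map_poly (chi \o polyC) p).[chi 'X] ].
Proof.
move=> [chiK chie chih].
have [hh hh'] : chi h%:P <> 0 /\ chi h' <> 0.
  by split=> e; apply: chih; rewrite rmorphM e ?mul0r ?mulr0.
split=> //.
- split=> [a|e e_in|]; [exact: chiK| |exact: hh].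
  by apply: chie; rewrite mem_cat map_f.
- by move=> e e_in; apply: chie; rewrite mem_cat e_in orbT.
move=> p; rewrite -[RHS](poly_extE (chi \o polyC)).
by apply: (@poly_hom_eq B K chi) => [b|]; rewrite ?poly_extC ?poly_extX.
Qed.

Lemma comp_polyXaddC_eq0 (R : comNzRingType) (p : {poly R}) c :
  p \Po ('X + c%:P) = 0 -> p = 0.
Proof.
move=> e; rewrite -[p]comp_polyXr.
have -> : 'X = ('X + c%:P) \Po ('X - c%:P) :> {poly R}.
  by rewrite comp_polyD comp_polyX comp_polyC subrK.
by rewrite comp_polyA e comp_poly0.
Qed.

(** A transcendental element is sent to its residue plus a new variable, for
    the same points of the algebra generated by [S]. *)
Lemma smooth_transcendental d S i : smooth d S ->
  (forall p, poly_over iota (fun x => x \in S) p -> p.[s i] = 0 -> p = 0) ->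
  smooth d.+1 (s i :: S).
Proof.
move=> [B [T [eqs [h [gS e0 h0 lift]]]]] trans; set R := power_series K d.
pose T' j : pr_adjoin B i := if j == d then 'X else (T j)%:P.
exists (pr_adjoin B i), T', (map polyC eqs ++ [::]), (h%:P * 1).
split; first exact: generated_adjoin.
- move=> e; rewrite cats0 => /mapP [e1 /e0 ee1 ->].
  by rewrite pr_ev_adjoinE map_polyC hornerC.
- by rewrite mulr1 pr_ev_adjoinE map_polyC hornerC.
move=> chi /point_restrict [pt _ _ chiE]; set c := chi 'X in chiE.
have [[rho rhoK rhores rhoker rhovar]] := lift _ pt.
pose u : pser R := ps_const (lr_emb R c) + ps_mono 1 1.
pose rho' : {rmorphism pr_adjoin B i -> power_series K d.+1} :=
  poly_ext (@ps_const R \o rho) u.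
have uE : u = ps_of_poly ('X + (lr_emb R c)%:P).
  rewrite rmorphD /= ps_of_polyC addrC; congr (_ + _); apply/funext => k.
  by rewrite /ps_mono /ps_of_poly coefX; case: eqP.
have rho'E p : rho' p = ps_of_poly (map_poly rho p \Po ('X + (lr_emb R c)%:P)).
  by rewrite ps_of_poly_horner -uE -map_poly_comp.
have resu : ps_coef0th u = lr_emb R c.
  by rewrite /ps_coef0th /u ps_coefD /ps_const /ps_mono addr0.
split; apply: (@Lifting d.+1 (pr_adjoin B i) _ _ rho').
- by move=> a; rewrite /rho' [LHS]poly_extC /= rhoK.
- move=> p; rewrite chiE.
  rewrite -(poly_extE (chi \o polyC)).
  apply: (@poly_hom_eq B K (@lr_res K d.+1 (power_series K d.+1) \o rho')) => [b|].
    rewrite poly_extC -[RHS]rhores.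
    by rewrite -[LHS]/(lr_res R (ps_coef0th (rho' b%:P))) [rho' _]poly_extC.
  rewrite poly_extX -[LHS]/(lr_res R (ps_coef0th (rho' 'X))) [rho' _]poly_extX.
  by rewrite resu lr_embK.
- move=> p; rewrite pr_ev_adjoinE rho'E; split=> [h1|h1].
    have: ps_of_poly (map_poly rho p \Po ('X + (lr_emb R c)%:P)) = ps_of_poly 0.
      by rewrite rmorph0.
    move=> /ps_of_poly_inj /comp_polyXaddC_eq0 /map_poly_eq0_iff rp.
    suff -> : map_poly (pr_ev B) p = 0 by rewrite horner0.
    by apply/map_poly_eq0_iff => j; apply/rhoker.
  suff -> : map_poly rho p = 0 by rewrite comp_poly0 rmorph0.
  apply/map_poly_eq0_iff => j; apply/rhoker; move: j; apply/map_poly_eq0_iff.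
  by apply: trans h1 => j; rewrite coef_map; apply: gS.1.
move=> j; rewrite ltnS leq_eqVlt /T' /= /lexS_var; case: eqP => [-> _|_ /= jd].
  by rewrite [LHS]poly_extX.
by rewrite [LHS]poly_extC /= rhovar // rmorphD.
Qed.

Lemma power_series_domain d : domain_like (power_series K d).
Proof.
move=> a b ab; have [->|a0] := pselect (a = 0); first by left.
have [->|b0] := pselect (b = 0); first by right.
by case: (lr_neq0M a0 b0 ab).
Qed.

(** The conditions added are that the point satisfies a minimal equation [m] of the
    new element, and that the derivative of [m] does not vanish there. Hensel's
    lemma then provides the image of the new element. *)
Lemma smooth_separable d S i : smooth d S ->
  simple_root_over iota (fun x => x \in S) (s i) -> smooth d (s i :: S).
Proof.
move=> [B [T [eqs [h [gS e0 h0 lift]]]]] [p0 [p0S p0s p0's]].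
set R := power_series K d.
have [f fE] := generated_poly gS p0S; rewrite -{}fE in p0s p0's.
have fn0 : map_poly (pr_ev B) f <> 0.
  by move=> e; apply: p0's; rewrite e deriv0 horner0.
have [m mm] := exists_minimal_vanishing fn0 p0s.
have [mn0 sm ms mmin] := mm.
have domF := @field_domain F.
(* [m] divides [f] up to a scalar, so it has no multiple root where [f] has none. *)
have m's : (map_poly (pr_ev B) m)^`().[s i] <> 0.
  have [k [q [r [e rm]]]] := pseudo_remainder f (minimal_vanishing_neq0 mm).
  have /(minimal_vanishing_remainder domF mm e rm) r0 := p0s.
  have := map_pseudo_remainder (pr_ev B) e; rewrite r0 addr0.
  move/(congr1 (fun u => u^`().[s i])); rewrite derivZ derivM hornerZ hornerD !hornerM.
  rewrite ms mulr0 add0r => eq m's; move: eq; rewrite m's mulr0 => /domF [|//].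
  exact: domain_likeX domF (minimal_vanishing_lead mm).
exists (pr_adjoin B i), (fun j => (T j)%:P), (map polyC eqs ++ [:: m]), (h%:P * m^`()).
split; first exact: generated_adjoin.
- move=> e; rewrite mem_cat inE => /orP[/mapP [e' /e0 ee' ->]|/eqP ->].
    by rewrite pr_ev_adjoinE map_polyC hornerC.
  by rewrite pr_ev_adjoinE.
- rewrite pr_ev_adjoinE rmorphM /= map_polyC hornerM hornerC -deriv_map.
  by move=> /domF [].
move=> chi /point_restrict [pt chim chim' chiE]; set c := chi 'X in chiE.
have [[rho rhoK rhores rhoker rhovar]] := lift _ pt.
have resE q : map_poly (lr_res R) (map_poly rho q) = map_poly (chi \o polyC) q.
  by rewrite -map_poly_comp; apply: eq_map_poly => b; rewrite /= rhores.
have [||y yc my] := lr_hensel (p := map_poly rho m) (c := c).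
- by rewrite resE -chiE chim ?mem_head.
- by rewrite resE deriv_map -chiE; apply/eqP.
split; apply: (@Lifting d (pr_adjoin B i) _ _ (poly_ext rho y)).
- by move=> a; rewrite [LHS]poly_extC rhoK.
- move=> p; rewrite chiE -(poly_extE (chi \o polyC)).
  apply: (@poly_hom_eq B K (lr_res R \o poly_ext rho y)) => [b|].
    by rewrite poly_extC /= [horner_morph _ _]poly_extC rhores.
  by rewrite poly_extX /= [horner_morph _ _]poly_extX.
- move=> p; rewrite pr_ev_adjoinE poly_extE.
  exact: (vanishing_same (@power_series_domain d) rhoker _ mm my).
by move=> j jd; rewrite [LHS]poly_extC rhovar.
Qed.

End Presentation.

(** * Places of the function field *)

Section DistinctPlaces.
Variables (K F : fieldType) (iota : {rmorphism K -> F}).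

(** The element [tau - a] has value 0 at [P], so its inverse is infinite there, and
    hence at [Q]. *)
Lemma place_equiv_value (P Q : fplace iota) tau a b : place_equiv P Q ->
  P tau = Some (fplace_emb P a) -> Q tau = Some (fplace_emb Q b) -> a = b.
Proof.
move=> PQ Pt Qt; pose x := tau + iota (- a).
have Px : P x = Some 0 by rewrite (placeD Pt (fplace_id P _)) -rmorphD subrr rmorph0.
have Qx : Q x = Some (fplace_emb Q (b - a)).
  by rewrite (placeD Qt (fplace_id Q _)) -rmorphD.
have [x0|x0] := eqVneq x 0.
  apply/eqP; rewrite eq_sym -subr_eq0 -(fmorph_eq0 (fplace_emb Q)); apply/eqP/Some_inj.
  by rewrite -Qx x0 -(rmorph0 iota) fplace_id rmorph0.
apply/eqP; rewrite eq_sym -subr_eq0 -(fmorph_eq0 (fplace_emb Q)); apply/eqP/Some_inj.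
rewrite -Qx; have : finite_on P x^-1 = false.
  apply/negP; rewrite /finite_on; case e: (P x^-1) => [c|//] _.
  have := placeM Px e; rewrite mulfV // place1 mul0r => -[] /eqP.
  by rewrite oner_eq0.
rewrite PQ /finite_on; case e: (Q x^-1) => [//|] _.
by rewrite -[x]invrK (placeV e).
Qed.

(** Places with pairwise distinct values at [tau] are inequivalent; each new place
    avoids the values used before. *)
Lemma infinitely_many_places_of_values (A : fplace iota -> Prop) tau :
  (forall l : seq K, exists P a,
     [/\ A P, a \notin l & P tau = Some (fplace_emb P a)]) ->
  infinitely_many_places A.
Proof.
move=> h; have ex : forall l : seq K, exists Pa : fplace iota * K,
    [/\ A Pa.1, Pa.2 \notin l & Pa.1 tau = Some (fplace_emb Pa.1 Pa.2)].
  by move=> l; have [P [a Pa]] := h l; exists (P, a).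
have [f fP] := choice ex.
pose used := fix used n := if n is n'.+1 then (f (used n')).2 :: used n' else [::].
have usedP i j : (i < j)%N -> (f (used i)).2 \in used j.
  elim: j => // j IH; rewrite ltnS leq_eqVlt inE => /orP[/eqP ->|/IH ->].
    by rewrite eqxx.
  by rewrite orbT.
have neq i j : (i < j)%N -> (f (used i)).2 <> (f (used j)).2.
  by move=> /usedP ij e; have [_ /negP] := fP (used j); rewrite -e.
exists (fun i => (f (used i)).1); split=> [i|i j ij]; first by have [] := fP (used i).
have [_ _ vi] := fP (used i); have [_ _ vj] := fP (used j).
have e := place_equiv_value ij vi vj.
by case: (ltngtP i j) => // /neq; rewrite e.
Qed.

End DistinctPlaces.

Section Smoothness.
Variables (K F : fieldType) (iota : {rmorphism K -> F}).
Variables (N : nat) (s : 'I_N -> F).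

Lemma smooth_independent d (t : d.-tuple F) : (forall x, x \in t -> exists i, x = s i) ->
  algebraically_independent iota t -> smooth iota s d t.
Proof.
elim: d t => [|d IH] t ts ind; first by rewrite tuple0; apply: smooth_nil.
case/tupleP: t ts ind => x t ts ind.
have [i xE] := ts x (mem_head _ _).
have eS : tval [tuple of x :: t] = s i :: t by rewrite /= xE.
rewrite eS; apply: smooth_transcendental.
  apply: IH (independent_behead ind) => y yt; apply: ts; rewrite inE yt orbT //.
by move=> p pS; rewrite -xE; apply: (independent_transcendental ind pS).
Qed.

Lemma smooth_tower d (t : d.-tuple F) S : (forall x, x \in S -> exists i, x = s i) ->
  algebraically_independent iota t -> separable_tower iota t S ->
  smooth iota s d S.
Proof.
move=> + ind tow; elim: tow => [ts|S' y tow IH root ts].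
  exact: smooth_independent.
have [i yE] := ts y (mem_head _ _).
rewrite yE; apply: smooth_separable; last by rewrite -yE.
by apply: IH => x xS; apply: ts; rewrite inE xS orbT.
Qed.

Variable d : nat.
Variables (B : presentation K N) (T : nat -> B).
Hypothesis ev_frac : forall x, exists a b : B,
  pr_ev iota s B b <> 0 /\ x = pr_ev iota s B a / pr_ev iota s B b.
Hypothesis trdeg : has_trdeg iota d.

Lemma place_of_lifting (chi : {rmorphism B -> K}) :
  (forall a, chi (pr_const B a) = a) -> inhabited (lifting iota s d T chi) ->
  exists P : fplace iota, [/\ rational_place P, maximal_rank P,
    forall b, finite_on P (pr_ev iota s B b)
  & P (pr_ev iota s B (T 0%N)) = Some (fplace_emb P (chi (T 0%N)))].
Proof.
move=> chiK [[rho rhoK rhores rhoker rhovar]].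
have evK := pr_ev_const iota s B.
pose P := lex_fplace evK rhoK rhoker ev_frac.
exists P; split; first exact: lex_fplace_rational.
- exists d; split=> //.
  apply: (@lex_place_rank _ _ _ _ _ _ _ rhoker ev_frac
    (fun i => T i - pr_const B (chi (T i)))) => i id.
  by rewrite rmorphB rhoK rhovar // addrC addKr.
- by move=> b; rewrite /finite_on [P _]lex_place_ev.
by rewrite [LHS]lex_place_ev rhores.
Qed.

(** The first element [T 0] is sent to a series that involves a variable, so it is
    not a constant. *)
Lemma lifting_nonconstant (chi : {rmorphism B -> K}) a : (0 < d)%N ->
  (forall a, chi (pr_const B a) = a) -> inhabited (lifting iota s d T chi) ->
  pr_ev iota s B (T 0%N - pr_const B a) <> 0.
Proof.
move=> d0 chiK [[rho rhoK rhores rhoker rhovar]] /rhoker.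
rewrite rmorphB rhoK rhovar // => e.
have : chi (T 0%N) = chi (T 0%N) + lr_res _ (lr_var (power_series K d) 0%N).
  by rewrite -[LHS]rhores rhovar // rmorphD lr_embK.
move/eqP; rewrite -subr_eq0 opprD addrA subrr sub0r oppr_eq0 => /eqP r0.
move: (congr1 (lr_res _) e); rewrite rmorphB rmorphD !lr_embK r0 rmorph0 addr0.
move/eqP; rewrite subr_eq0 => /eqP ca; move: e; rewrite ca addrC addKr.
exact: lr_exact_neq0 (lr_exact_var _ d0).
Qed.

End Smoothness.

Theorem theorem23 (K F : fieldType) (iota : {rmorphism K -> F})
    (hF : function_field iota) (hK : existentially_closed iota)
    (n : nat) (z : 'I_n -> F) :
  infinitely_many_places (fun P : fplace iota =>
    [/\ rational_place P, maximal_rank P & forall i, finite_on P (z i)]).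
Proof.
have [[s0 gen] [d0 [d0_gt0 [t0 [ind0 _]]]]] := hF.
pose s1 := s0 ++ [seq z i | i : 'I_n].
have [d [t [S [ind tow Ss1]]]] := exists_separable_tower s1 hK.
have s0S : {subset s0 <= S} by move=> x xs0; rewrite Ss1 mem_cat xs0.
have trdeg : has_trdeg iota d.
  by exists t; apply: tower_transcendence_basis gen s0S ind tow.
(* If [d] were 0, the first element of [t0] would be algebraic over [K]. *)
have d_gt0 : (0 < d)%N.
  rewrite lt0n; apply/eqP => dE; subst d; case: d0 d0_gt0 t0 ind0 => // d0 _.
  case/tupleP=> x t0 ind0; have xalg := tower_all_algebraic gen s0S tow x.
  have [p [p0 pS px]] := algebraic_relation xalg.
  move: p0; rewrite (independent_transcendental ind0 _ px) ?eqxx // => i.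
  by apply: subalg_mono (pS i) => y; rewrite tuple0.
pose s := tnth (in_tuple S).
have Ss x : x \in S -> exists i, x = s i by move=> /(@tnthP _ _ (in_tuple S)).
have [B [T [eqs [h [gB eqs0 h0 lift]]]]] := smooth_tower Ss ind tow.
have ev_frac x : exists a b : B,
    pr_ev iota s B b <> 0 /\ x = pr_ev iota s B a / pr_ev iota s B b.
  have /asboolP[a [b [aS bS b0 ->]]] :
      x \in in_subalg_frac iota (fun y => y \in S).
    apply: gen => [|a|y /s0S yS]; first exact: subalg_frac_divring_closed.
      exact/asboolP/subalg_frac_subalg/subalg_const.
    exact/asboolP/subalg_frac_subalg/subalg_gen.
  have [a' <-] := generated_subalg gB aS; have [b' b'E] := generated_subalg gB bS.
  by exists a', b'; rewrite b'E; split=> //; apply/eqP.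
apply: (@infinitely_many_places_of_values _ _ _ _ (pr_ev iota s B (T 0%N))) => l.
have nonconst a : pr_ev iota s B (T 0%N - pr_const B a) <> 0.
  have [chi pt] := exists_rational_point hK eqs0 h0; have [chiK _ _] := pt.
  exact: lifting_nonconstant d_gt0 chiK (lift chi pt).
(* Excluding the values in [l] for [T 0] is one more open condition on the point. *)
pose h' := h * \prod_(a <- l) (T 0%N - pr_const B a).
have [|chi [chiK chie chih']] := exists_rational_point hK (h := h') eqs0.
  rewrite rmorphM rmorph_prod; apply/eqP; rewrite mulf_neq0 //; first exact/eqP.
  by rewrite prodf_seq_neq0; apply/allP => a _; apply/implyP => _; apply/eqP/nonconst.
have pt : rational_point eqs h chi.
  by split=> // hh; apply: chih'; rewrite rmorphM hh mul0r.
have [P [Prat Pmax Pfin Pt]] := place_of_lifting ev_frac trdeg chiK (lift chi pt).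
exists P, (chi (T 0%N)); split=> //.
  split=> // i; have /(gB.2 _) [b <-] : z i \in S.
    by rewrite Ss1 mem_cat map_f ?orbT ?mem_enum.
  exact: Pfin.
apply/negP => in_l; apply: chih'; rewrite rmorphM rmorph_prod.
rewrite (big_rem _ in_l) /= rmorphB chiK subrr mul0r mulr0 //.
Qed.
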